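(* For every real number $c\geq 1$ there is a Jordan arc $\Lambda$ with $\dim_C \Lambda=c$.
   Context: A Jordan arc is a metric space homeomorphic to $[0,1]$ with its usual topology. An embedding $f:X\rightarrow Y$ between metric spaces $(X,d_X)$ and $(Y,d_Y)$ is quasisymmetric if there is a homeomorphism $\eta:[0,\infty)\rightarrow[0,\infty)$ such that $$\frac{d_Y(f(x),f(a))}{d_Y(f(x),f(b))}\leq \eta\left(\frac{d_X(x,a)}{d_X(x,b)}\right)$$ for all triples $a,b,x$ of points in $X$ with $x\neq b$. $\dim_H$ denotes Hausdorff dimension. The conformal dimension of a metric space $X$ is $$\dim_C X=\inf\{\dim_H f(X): f \text{ is quasisymmetric}\},$$ where the infimum is over all quasisymmetric embeddings $f$ of $X$ into metric spaces. *)

(* Defs.v *)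
From HB Require Import structures.
From mathcomp Require Import all_boot all_order all_algebra.
From mathcomp Require Import all_classical all_reals all_analysis.
Import Order.TTheory GRing.Theory Num.Theory.
Import numFieldNormedType.Exports.

Set Implicit Arguments.
Unset Strict Implicit.
Unset Printing Implicit Defensive.

Local Open Scope classical_set_scope.
Local Open Scope ring_scope.

(* [f] restricts to a homeomorphism from the subspace [A] onto the subspace
   [B]. The inverse [g] is typed on [B], not on [Y], so that it also exists
   when [X] is empty and [Y] is not. *)
Definition homeomorphism (X Y : topologicalType) (A : set X) (B : set Y)
    (f : X -> Y) : Prop :=
  [/\ set_bij A B f,
      {within A, continuous f} &
      exists g : B -> X,
        continuous g /\ forall y : B, A (g y) /\ f (g y) = \val y].

Definition jordan_arc (R : realType) (X : metricType R) : Prop :=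
  exists h : R -> X, homeomorphism `[0 : R, 1] [set: X] h.

Definition embedding (X Y : topologicalType) (f : X -> Y) : Prop :=
  homeomorphism [set: X] (range f) f.

Definition quasisymmetric (R : realType) (X Y : metricType R) (f : X -> Y) :
    Prop :=
  embedding f /\
  exists eta : R -> R, homeomorphism `[0 : R, +oo[ `[0 : R, +oo[ eta /\
    forall a b x : X, x <> b ->
      mdist (f x) (f a) / mdist (f x) (f b)
        <= eta (mdist x a / mdist x b).

Section hausdorff_dimension.
Context (R : realType) (X : metricType R).
Implicit Types (A : set X) (s delta : R).
Local Open Scope ereal_scope.

(* The point [0] is added because [ereal_sup set0 = -oo]. *)
Definition diameter A : \bar R :=
  ereal_sup (0 |` [set (mdist p.1 p.2)%:E | p in A `*` A]).

(* The case distinction is the usual convention that the empty set contributes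
   [0] also when [s = 0]; a singleton then contributes [0 `^ 0 = 1]. *)
Definition diam_pow s A : \bar R :=
  if A == set0 then 0 else diameter A `^ s.

Definition hausdorff_premeasure s delta A : \bar R :=
  ereal_inf [set \sum_(0 <= i <oo) diam_pow s (U i) |
    U in [set U : nat -> set X |
           A `<=` \bigcup_i U i /\ forall i, diameter (U i) <= delta%:E]].

Definition hausdorff_measure s A : \bar R :=
  ereal_sup [set hausdorff_premeasure s delta A |
    delta in [set delta : R | (0 < delta)%R]].

Definition hausdorff_dim A : \bar R :=
  ereal_inf [set s%:E |
    s in [set s : R | (0 <= s)%R /\ hausdorff_measure s A = 0]].

End hausdorff_dimension.

(* Covering sets may be intersected with [range f] without increasing their
   diameter, so the dimension of [range f] inside [Y] is its dimension as a
   metric space. *)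
Definition conformal_dim (R : realType) (X : metricType R) : \bar R :=
  ereal_inf [set d | exists (Y : metricType R) (f : X -> Y),
    quasisymmetric f /\ d = hausdorff_dim (range f)].

(* Main.v *)
Require Import Defs.
From mathcomp Require Import all_boot all_order all_algebra.
From mathcomp Require Import all_classical all_reals all_analysis.
From HB Require Import structures.
From mathcomp Require Import zify ring lra.
Import Order.TTheory GRing.Theory Num.Theory.
Import numFieldNormedType.Exports.

Set Implicit Arguments.
Unset Strict Implicit.
Unset Printing Implicit Defensive.

(** The arc is the graph of a self-affine function [h] (called [height]) over
    [0,1]. Cut the range of [h] into [M] blocks; inside each block the graph runs
    through the whole height of the block [N] times, alternately up and down ([N]
    is odd), and each of these runs is an affine copy of the whole graph. The
    copies of level [k], the strokes, last a time [B^-k] with [B = M * N] and have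
    height [M^-k]. The distance is the maximum of [|h s - h t|] and of the
    snowflake [|s - t|^p], so that a stroke of level [k] has width [rho^k] with
    [rho = B^-p]. The parameters are chosen with [M * rho < 1], which makes strokes
    thin and tall, and with [rho^e = 1/N] where [e = c - 1].

    Upper bound. Let [rho^l] be comparable to [M^-k]. A cell of level [k] is the
    part of the graph in the product of a time interval of length [B^-l] and a
    height interval of length [M^-k]; its diameter is comparable to [M^-k], and
    [M^k * N^l], that is about [M^(k (1 + e))], cells cover the arc. Hence the
    Hausdorff dimension is at most [1 + e] ([hausdorff_measure_arc0]).

    Lower bound. Let [f] be quasisymmetric. A lane keeps, in every block, one of
    the [N] strokes. It climbs from the bottom to the top of its block and is
    broken only by horizontal gaps, which at level [k] are shorter than the strokes
    by a factor of order [(M * rho)^k]. As the arc is connected, [f] turns this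
    geometric decay into a geometric decay of the relative size of the images of
    the gaps ([qs_decay]). So, up to factors whose product converges, the
    displacement of a stroke under [f] is at most the sum of the displacements of
    the strokes of any lane in it ([span_lanes]). Averaging over the lanes, the sum
    of [N^-l * diam (f Q)] over the cells [Q] of a cover stays away from zero.
    Subtract from this average a small multiple [eps] of the uniform measure. A
    cell with [diam (f Q)] much smaller than [eps * M^-k] then counts negatively,
    and for any other one [N^-l = (rho^l)^e] is at most a constant times
    [(diam (f Q))^e]; thus every cell counts for at most a constant times
    [(diam (f Q))^(1 + e)] ([mass_le]). A set of a cover of the image pulls back
    into at most 16 cells of one level, whose images have comparable diameter
    ([cover_weight]). If the sum of the [(1 + e)]-th powers of the diameters were
    small, one could descend in the tree of cells along cells whose mass exceeds
    everything that the cover puts below them ([heavy_branch]); the point to which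
    they shrink would not be covered. Therefore every quasisymmetric image has
    positive [(1 + e)]-dimensional content ([image_content_gt]).

    For [c = 1] the same argument is applied with [N = 1] to the segment, whose
    usual distance satisfies the same axioms [arc_dist]. *)

Local Open Scope classical_set_scope.
Local Open Scope ring_scope.

(** * Strokes of the zigzag *)

Section Walk.
Local Open Scope nat_scope.
Variables M N : nat.
Hypothesis M_gt0 : 0 < M.
Hypothesis N_odd : odd N.

(** The [n]-th stroke of level [k] in order of time, coded by the index of the
    height interval of length [M^-k] that it crosses and by whether it crosses it
    upwards. The child with digits [i < M] and [j < N] is the [j]-th crossing of the
    [i]-th block met by the parent. *)
Fixpoint stroke (k n : nat) : nat * bool :=
  if k is k'.+1 then
    let: (y, b) := stroke k' (n %/ (M * N)) in
    let a := n %% (M * N) in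
    (M * y + (if b then a %/ N else M.-1 - a %/ N), b (+) odd (a %% N))
  else (n, true).

Definition stroke_lo k n := (stroke k n).1.
Definition stroke_up k n := (stroke k n).2.
(** Heights at the two ends of a stroke, in units of [M^-k]. *)
Definition stroke_start k n := stroke_lo k n + ~~ stroke_up k n.
Definition stroke_stop k n := stroke_lo k n + stroke_up k n.

Lemma N_gt0 : 0 < N. Proof. by case: (N) N_odd. Qed.
Local Notation B := (M * N).
Lemma B_gt0 : 0 < B. Proof. by rewrite muln_gt0 M_gt0 N_gt0. Qed.

Lemma digit_lt i j : i < M -> j < N -> i * N + j < B.
Proof.
move=> iM jN; apply: (@leq_trans (i.+1 * N)); last by rewrite leq_mul2r iM orbT.
by rewrite mulSn addnC ltn_add2r.
Qed.

Lemma stroke_child k n i j : i < M -> j < N ->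
  stroke k.+1 (n * B + (i * N + j)) =
  (M * stroke_lo k n + (if stroke_up k n then i else M.-1 - i), stroke_up k n (+) odd j).
Proof.
move=> iM jN; have ijB := digit_lt iM jN.
rewrite /= divnMDl ?B_gt0// divn_small// addn0 modnMDl modn_small//.
rewrite divnMDl ?N_gt0// divn_small// addn0 modnMDl modn_small//.
by rewrite /stroke_lo /stroke_up; case: (stroke k n).
Qed.

Lemma lo_child k n i j : i < M -> j < N ->
  stroke_lo k.+1 (n * B + (i * N + j)) =
  M * stroke_lo k n + (if stroke_up k n then i else M.-1 - i).
Proof. by move=> iM jN; rewrite {1}/stroke_lo stroke_child. Qed.

Lemma up_child k n i j : i < M -> j < N ->
  stroke_up k.+1 (n * B + (i * N + j)) = stroke_up k n (+) odd j.
Proof. by move=> iM jN; rewrite {1}/stroke_up stroke_child. Qed.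

Lemma digitsP n : exists i j, [/\ i < M, j < N &
  n = (n %/ B) * B + (i * N + j)].
Proof.
exists ((n %% B) %/ N), ((n %% B) %% N); split.
- by rewrite ltn_divLR ?N_gt0// ltn_mod B_gt0.
- by rewrite ltn_mod N_gt0.
- by rewrite -divn_eq -divn_eq.
Qed.

Lemma lo_parent k n : stroke_lo k.+1 n %/ M = stroke_lo k (n %/ B).
Proof.
have [i [j [iM jN ->]]] := digitsP n.
rewrite lo_child// mulnC divnMDl// divnMDl ?B_gt0//.
rewrite [(_ * N + _) %/ _]divn_small ?digit_lt// addn0.
by rewrite [(if _ then _ else _) %/ _]divn_small ?addn0//; case: ifP => // _; lia.
Qed.

Lemma start_first k n : stroke_start k.+1 (n * B) = M * stroke_start k n.
Proof.
have nE : n * B = n * B + (0 * N + 0) by rewrite mul0n !addn0.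
rewrite /stroke_start nE lo_child ?N_gt0// up_child ?N_gt0//= addbF.
by case: (stroke_up k n) => /=; lia.
Qed.

(** The zigzag is continuous. Inside a block consecutive strokes turn round at a
    common end; since [N] is odd the last stroke of a block leaves it where the next
    block begins, and ends of level [k + 1] refine those of level [k]. *)
Lemma stop_start k n : stroke_stop k n = stroke_start k n.+1.
Proof.
elim: k n => [|k IH] n; first by
  rewrite /stroke_stop /stroke_start /stroke_lo /stroke_up /= addn0 addn1.
have [i [j [iM jN nE]]] := digitsP n; set q := n %/ B in nE.
have stE : stroke_stop k.+1 n = M * stroke_lo k q + (if stroke_up k q then i else M.-1 - i)
    + (stroke_up k q (+) odd j).
  by rewrite /stroke_stop {1}nE lo_child// nE up_child.
have [jN1|jN1] := ltnP j.+1 N.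
  have n1E : n.+1 = q * B + (i * N + j.+1) by rewrite nE; lia.
  by rewrite stE /stroke_start n1E lo_child// up_child//=; case: (stroke_up k q); case: (odd j).
have jE : j = N.-1 by lia.
have oj : odd j = false.
  by move: N_odd; rewrite -(prednK N_gt0) -jE /=; case: (odd j).
have [iM1|iM1] := ltnP i.+1 M.
  have n1E : n.+1 = q * B + (i.+1 * N + 0) by rewrite nE jE; have := N_gt0; nia.
  rewrite stE /stroke_start n1E lo_child ?N_gt0// up_child ?N_gt0// oj /= !addbF.
  by case: (stroke_up k q) => /=; lia.
have iE : i.+1 = M by lia.
have n1E : n.+1 = q.+1 * B.
  by rewrite nE jE -!addnS prednK ?N_gt0// -mulSnr iE -mulSnr.
rewrite stE n1E start_first -IH /stroke_stop oj addbF.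
have -> : i = M.-1 by lia.
by case: (stroke_up k q); rewrite /= ?mulnDr ?muln1 ?muln0 ?subnn; have := M_gt0; lia.
Qed.

Lemma start_mul k r n : stroke_start (k + r) (n * B ^ r) = M ^ r * stroke_start k n.
Proof.
elim: r => [|r IH]; first by rewrite addn0 !expn0 muln1 mul1n.
by rewrite addnS expnSr mulnA start_first IH expnS mulnA.
Qed.

Lemma lo_anc k r n : stroke_lo (k + r) n %/ M ^ r = stroke_lo k (n %/ B ^ r).
Proof.
elim: r n => [|r IH] n; first by rewrite addn0 !expn0 !divn1.
by rewrite addnS !expnS divnMA lo_parent IH (divnMA n B).
Qed.

Lemma start_bounds k n : stroke_lo k n <= stroke_start k n <= (stroke_lo k n).+1.
Proof.
by rewrite /stroke_start; case: (stroke_up k n); rewrite /= ?addn0 ?addn1 !leqnn leqnSn.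
Qed.

Lemma stop_bounds k n : stroke_lo k n <= stroke_stop k n <= (stroke_lo k n).+1.
Proof.
by rewrite /stroke_stop; case: (stroke_up k n); rewrite /= ?addn0 ?addn1 !leqnn leqnSn.
Qed.

End Walk.

Section Counting.
Local Open Scope nat_scope.
Variables M N : nat.
Hypothesis M_gt0 : 0 < M.
Hypothesis N_odd : odd N.
Local Notation B := (M * N).

Lemma big_children (T : Type) (idx : T) (op : Monoid.com_law idx) (K : nat)
    (P : pred nat) (F : nat -> T) :
  \big[op/idx]_(0 <= n < K * B | P (n %/ B)) F n =
  \big[op/idx]_(0 <= n < K | P n)
    \big[op/idx]_(0 <= i < M) \big[op/idx]_(0 <= j < N) F (n * B + (i * N + j)).
Proof.
rewrite big_mkcond big_nat_mul [RHS]big_mkcond; apply: eq_bigr => n _.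
have B0 := B_gt0 M_gt0 N_odd.
have -> : \big[op/idx]_(n * B <= m < n.+1 * B)
    (if P (m %/ B) then F m else idx) =
  \big[op/idx]_(0 <= a < B) (if P n then F (n * B + a) else idx).
  rewrite -[n * B in LHS]add0n big_addn mulSn addnK; apply: eq_big_nat => a /andP[_ aB].
  by rewrite addnC divnMDl// divn_small// addn0.
case: ifP => _; last by rewrite big1.
rewrite big_nat_mul; apply: eq_bigr => i _.
rewrite -[i * N in LHS]add0n big_addn mulSn addnK; apply: eq_big_nat => a _.
by rewrite [a + _]addnC.
Qed.

(** Each child interval of heights is crossed by exactly [N] children of a stroke. *)
Lemma count_strokes K l r q y :
  \sum_(0 <= n < K * B ^ r | (n %/ B ^ r == q) && (stroke_lo M N (l + r) n == y)) 1
    <= N ^ r.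
Proof.
elim: r y => [|r IH] y.
  rewrite !expn0 muln1 addn0; under eq_bigl do rewrite divn1.
  rewrite big_mkcondr -big_filter.
  have : size [seq i <- index_iota 0 K | i == q] <= 1.
    by rewrite size_filter (count_uniq_mem _ (iota_uniq _ _)) leq_b1.
  case: [seq _ <- _ | _] => [|a [|//]] _; first by rewrite big_nil.
  by rewrite big_seq1; case: ifP.
rewrite expnSr mulnA addnS.
under eq_bigl => n do rewrite mulnC divnMA.
rewrite big_mkcondr/= (big_children _ _ (fun n => n %/ B ^ r == q)).
apply: (@leq_trans (\sum_(0 <= n < K * B ^ r | (n %/ B ^ r == q))
   (stroke_lo M N (l + r) n == y %/ M) * N)).
  apply: leq_sum => n _.
  have [loE|lone] := boolP (stroke_lo M N (l + r) n == y %/ M); last first.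
    rewrite big_nat_cond big1// => i /andP[/andP[_ iM] _].
    rewrite big_nat_cond big1// => j /andP[/andP[_ jN] _].
    case: eqP => // yE; case/negP: lone; apply/eqP.
    rewrite -yE (lo_parent M_gt0 N_odd) divnMDl ?(B_gt0 M_gt0 N_odd)//.
    by rewrite [(_ * N + _) %/ _]divn_small ?digit_lt// addn0.
  rewrite mul1n exchange_big/=.
  apply: (@leq_trans (\sum_(0 <= j < N) 1)); last by rewrite sum_nat_const_nat subn0 muln1.
  rewrite [leqLHS]big_nat_cond [leqRHS]big_nat_cond.
  apply: leq_sum => j /andP[/andP[_ jN] _].
  set i0 := if stroke_up M N (l + r) n then y - M * stroke_lo M N (l + r) n else
    M.-1 - (y - M * stroke_lo M N (l + r) n).
  rewrite -big_mkcond/=.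
  apply: (@leq_trans (\sum_(0 <= i < M | i == i0) 1)).
    rewrite big_nat_cond [leqRHS]big_nat_cond big_mkcond [leqRHS]big_mkcond.
    apply: leq_sum => i _; case: ifP => // /andP[iM]; rewrite iM /=.
    move: iM => /andP[_ iM]; rewrite lo_child// => /eqP yE.
    suff -> : i == i0 by [].
    by rewrite /i0 -yE; case: (stroke_up _ _ _ _); apply/eqP; lia.
  rewrite -big_filter.
  have : size [seq i <- index_iota 0 M | i == i0] <= 1.
    by rewrite size_filter (count_uniq_mem _ (iota_uniq _ _)) leq_b1.
  by case: [seq _ <- _ | _] => [|a [|//]] _; rewrite ?big_nil ?big_seq1.
rewrite -big_distrl/= expnSr leq_mul2r; apply/orP; right.
apply: leq_trans (IH (y %/ M)); rewrite [leqRHS]big_mkcondr/=.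
by apply: leq_sum => n _; case: eqP.
Qed.
End Counting.

(** * The height function *)

Section Real_lemmas.
Variable R : realType.
Implicit Types q C e x : R.

Lemma exists_expr_lt q C e : 0 <= q < 1 -> 0 < e -> exists k : nat, C * q ^+ k < e.
Proof.
move=> /andP[q0 q1] e0.
have : C * q ^+ k @[k --> \oo] --> (0 : R).
  by apply: cvg_geometric; rewrite ger0_norm.
move=> /cvgrPdist_lt/(_ _ e0)[k _ /(_ k (leqnn k))].
rewrite sub0r normrN => Ck; exists k; exact: le_lt_trans (ler_norm _) Ck.
Qed.

Lemma le0_geometric q C x : 0 <= q < 1 -> (forall k : nat, x <= C * q ^+ k) -> x <= 0.
Proof.
move=> q01 xC; rewrite leNgt; apply/negP => x0.
by have [k] := exists_expr_lt C q01 x0; rewrite ltNge xC.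
Qed.
End Real_lemmas.

Section Height.
Variables (R : realType) (M N : nat).
Hypothesis M_gt1 : (1 < M)%N.
Hypothesis N_odd : odd N.
Local Notation B := (M * N)%N.
Implicit Types t : R.

Let M_gt0 : (0 < M)%N. Proof. exact: ltnW. Qed.
Let B_gt0' : (0 < B)%N. Proof. exact: B_gt0. Qed.
Let MR0 k : 0 < M%:R ^+ k :> R. Proof. by rewrite exprn_gt0// ltr0n. Qed.
Let BR0 k : 0 < B%:R ^+ k :> R. Proof. by rewrite exprn_gt0// ltr0n. Qed.

Lemma invM_lt1 : 0 <= (M%:R^-1 : R) < 1.
Proof. by rewrite invr_ge0 ler0n invf_lt1 ?ltr0n// ltr1n. Qed.

Definition column k t := Num.truncn (B%:R ^+ k * t).

(** The lower ends of the nested height intervals increase with [k], so their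
    supremum is the height at time [t]. *)
Definition height t : R :=
  sup (range (fun k => (stroke_lo M N k (column k t))%:R / M%:R ^+ k)).

Lemma column_itv k t : 0 <= t -> (column k t)%:R <= B%:R ^+ k * t < (column k t).+1%:R.
Proof. by move=> t0; apply: truncn_itv; rewrite mulr_ge0// ltW. Qed.

Lemma column_anc k r t : 0 <= t -> (column (k + r) t %/ B ^ r)%N = column k t.
Proof.
move=> t0; apply/esym/truncn_def; have /andP[] := column_itv (k + r) t0.
set n := column _ t; have Br : (0 < B ^ r)%N by rewrite expn_gt0 B_gt0'.
have BrR : 0 < (B ^ r)%:R :> R by rewrite ltr0n.
have -> : B%:R ^+ (k + r) * t = (B ^ r)%:R * (B%:R ^+ k * t).
  by rewrite [in RHS]natrX exprD mulrCA mulrA.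
move=> n1 n2; apply/andP; split.
- rewrite -(ler_pM2l BrR); apply: le_trans n1; rewrite -natrM ler_nat mulnC.
  exact: leq_divM.
- rewrite -(ltr_pM2l BrR); apply: lt_le_trans n2 _; rewrite -natrM ler_nat.
  by rewrite mulnC ltn_ceil.
Qed.

Lemma lo_nest k r n :
  (stroke_lo M N k (n %/ B ^ r))%:R <= (stroke_lo M N (k + r) n)%:R / M%:R ^+ r :> R /\
  ((stroke_lo M N (k + r) n)%:R + 1) / M%:R ^+ r <= (stroke_lo M N k (n %/ B ^ r))%:R + 1 :> R.
Proof.
rewrite -(lo_anc M_gt0 N_odd) ler_pdivlMr// ler_pdivrMr//.
have Mr : (0 < M ^ r)%N by rewrite expn_gt0 M_gt0.
split; first by rewrite -natrX -natrM ler_nat leq_divM.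
by rewrite -natrX !natr1 -natrM ler_nat ltn_ceil.
Qed.

Lemma height_column k t : 0 <= t ->
  (stroke_lo M N k (column k t))%:R <= M%:R ^+ k * height t
    <= (stroke_lo M N k (column k t))%:R + 1.
Proof.
move=> t0.
have H j : (stroke_lo M N j (column j t))%:R / M%:R ^+ j <=
    ((stroke_lo M N k (column k t))%:R + 1) / M%:R ^+ k :> R.
  have [/subnKC jk|/ltnW /subnKC kj] := leqP j k.
    rewrite -(column_anc j (k - j) t0) jk.
    have [+ _] := lo_nest j (k - j) (column k t); rewrite jk => h.
    apply: (@le_trans _ _ ((stroke_lo M N k (column k t))%:R / M%:R ^+ k)).
      have -> : M%:R ^+ k = M%:R ^+ j * M%:R ^+ (k - j) :> R by rewrite -exprD jk.
      by rewrite invfM mulrCA mulrC ler_pM2l ?invr_gt0.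
    by rewrite ler_pM2r ?invr_gt0// lerDl.
  rewrite -(column_anc k (j - k) t0) kj.
  have [_] := lo_nest k (j - k) (column j t); rewrite kj => h.
  apply: (@le_trans _ _ (((stroke_lo M N j (column j t))%:R + 1) / M%:R ^+ j)).
    by rewrite ler_pM2r ?invr_gt0// lerDl.
  have -> : M%:R ^+ j = M%:R ^+ k * M%:R ^+ (j - k) :> R by rewrite -exprD kj.
  by rewrite invfM mulrCA [leRHS]mulrC ler_pM2l ?invr_gt0.
have ub : ubound (range (fun k => (stroke_lo M N k (column k t))%:R / M%:R ^+ k))
    (((stroke_lo M N k (column k t))%:R + 1) / M%:R ^+ k : R) by move=> _ [j _ <-].
apply/andP; split.
- rewrite mulrC -ler_pdivrMr//; apply: ub_le_sup; last by exists k.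
  by exists (((stroke_lo M N k (column k t))%:R + 1) / M%:R ^+ k).
- by rewrite mulrC -ler_pdivlMr//; apply: ge_sup ub;
  exists ((stroke_lo M N 0 (column 0 t))%:R / M%:R ^+ 0), 0%N.
Qed.

(** The intervals of all finer levels have one and the same end in common. *)
Lemma height_vertex k n : M%:R ^+ k * height (n%:R / B%:R ^+ k) = (stroke_start M N k n)%:R.
Proof.
set t := _ / _; have t0 : 0 <= t by rewrite divr_ge0// ltW.
have colE r : column (k + r) t = (n * B ^ r)%N.
  apply: truncn_def; rewrite exprD mulrC mulrA /t divfK ?gt_eqF// -natrX -natrM.
  by rewrite lexx ltr_nat leqnn.
suff h : forall r, `|M%:R ^+ k * height t - (stroke_start M N k n)%:R| <= 1 * M%:R^-1 ^+ r.
  by have := le0_geometric invM_lt1 h; rewrite normr_le0 subr_eq0 => /eqP.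
move=> r; have := height_column (k + r) t0; rewrite colE => /andP[h1 h2].
have := start_bounds M N (k + r) (n * B ^ r); rewrite (start_mul M_gt0 N_odd).
move=> /andP[]; rewrite -!(ler_nat R) natrM natrX -natr1 => h3 h4.
rewrite exprVn ler_pdivlMr// -[X in _ * X](gtr0_norm (MR0 r)) -normrM.
move: h1 h2; rewrite exprD => h1 h2; rewrite ler_norml.
by apply/andP; split; lra.
Qed.

(** Includes the right end of the time interval, where the column of [t] is already
    that of the next stroke. *)
Lemma height_stroke k n t : n%:R <= B%:R ^+ k * t <= n%:R + 1 ->
  (stroke_lo M N k n)%:R <= M%:R ^+ k * height t <= (stroke_lo M N k n)%:R + 1.
Proof.
move=> /andP[nt]; rewrite le_eqVlt => /orP[/eqP tE|tn].
  have -> : t = n.+1%:R / B%:R ^+ k by rewrite -natr1 -tE mulrC mulKf// gt_eqF.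
  rewrite height_vertex -stop_start// natr1 !ler_nat.
  by rewrite stop_bounds.
have t0 : 0 <= t by rewrite -(pmulr_rge0 _ (BR0 k)); apply: le_trans nt.
have <- : column k t = n by apply: truncn_def; rewrite nt -natr1.
exact: height_column.
Qed.
End Height.

(** * Sub-additive weights on a tree *)

Section Tree.
Variables (R : realType) (T : eqType).
Variables (par : nat -> T -> T) (ch : nat -> T -> seq T).
Hypothesis mem_ch : forall k Q Q', (Q' \in ch k Q) = (par k Q' == Q).
Hypothesis uniq_ch : forall k Q, uniq (ch k Q).
Variable phi : nat -> T -> R.
Hypothesis phi_sub : forall k Q, phi k Q <= \sum_(Q' <- ch k Q) phi k.+1 Q'.
Variables (lev : nat -> nat) (L : nat -> seq T) (w : nat -> R).
Hypothesis w_ge0 : forall i, 0 <= w i.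

Fixpoint anc k m (Q : T) := if m is m'.+1 then par k (anc k.+1 m' Q) else Q.

Definition weight_below n k Q : R :=
  \sum_(i < n | (k <= lev i)%N) w i * (count (fun P => anc k (lev i - k) P == Q) (L i))%:R.

Lemma weight_below_mono k Q m n : (m <= n)%N -> weight_below m k Q <= weight_below n k Q.
Proof.
move=> mn; rewrite /weight_below.
rewrite (big_ord_widen_cond n (fun i => (k <= lev i)%N)
  (fun i => w i * (count (fun P => anc k (lev i - k) P == Q) (L i))%:R))//.
rewrite [leRHS](bigID (fun i : 'I_n => (i < m)%N))/= lerDl.
by apply: sumr_ge0 => i _; rewrite mulr_ge0.
Qed.

Lemma weight_below_ge0 n k Q : 0 <= weight_below n k Q.
Proof. by apply: sumr_ge0 => i _; rewrite mulr_ge0. Qed.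

Lemma sum_count_fibers (f : T -> T) (s r : seq T) : uniq s ->
  (\sum_(x <- s) count (fun P => f P == x) r = count (fun P => f P \in s) r)%N.
Proof.
move=> us; elim: r => [|P r IH] /=; first by rewrite big1.
rewrite big_split/= IH -(count_uniq_mem _ us) -[count_mem _ _]sum1_count; congr addn.
by rewrite [RHS]big_mkcond; apply: eq_bigr => x _; rewrite /= eq_sym; case: eqP.
Qed.

Lemma weight_below_children n k Q :
  \sum_(Q' <- ch k Q) weight_below n k.+1 Q' <= weight_below n k Q.
Proof.
rewrite /weight_below exchange_big/= big_mkcond [leRHS]big_mkcond/=.
apply: ler_sum => i _; case: ltnP => ki; last first.
  by case: ifP => // _; rewrite mulr_ge0.
rewrite (ltnW ki) -mulr_sumr ler_wpM2l// -natr_sum ler_nat sum_count_fibers//.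
have -> : (lev i - k = (lev i - k.+1).+1)%N by lia.
by under eq_count do rewrite mem_ch.
Qed.

(** The mass of [Q] exceeds, with room to spare, all the weight that the cover puts
    on descendants of [Q]. The room is what makes [phi k Q] positive, and so
    excludes cells without strokes. *)
Definition heavy k Q := exists2 eta, 0 < eta & forall n, weight_below n k Q + eta <= phi k Q.

Lemma heavy_phi_gt0 k Q : heavy k Q -> 0 < phi k Q.
Proof.
by move=> [eta eta0 /(_ 0)]; apply: lt_le_trans; rewrite ltr_wpDl ?weight_below_ge0.
Qed.

(** If no child were heavy, then finitely many members of the cover would outweigh,
    up to a small error, all the finitely many children together, hence [Q]. *)
Lemma heavy_child k Q : heavy k Q -> exists2 Q', par k Q' = Q & heavy k.+1 Q'.
Proof.
move=> [eta eta0 hQ]; apply: contrapT => noQ'.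
have light Q' : Q' \in ch k Q -> ~ heavy k.+1 Q'.
  by rewrite mem_ch => /eqP pQ' hQ'; apply: noQ'; exists Q'.
pose eps := eta / (size (ch k Q)).+1%:R.
have eps0 : 0 < eps by rewrite divr_gt0.
have [n hn] : exists n, forall Q', Q' \in ch k Q ->
    phi k.+1 Q' <= weight_below n k.+1 Q' + eps.
  elim: (ch k Q) light => [|Q' s IH] light; first by exists 0%N.
  have [|n hn] := IH; first by move=> P Ps; apply: light; rewrite inE Ps orbT.
  have [m hm] : exists m, phi k.+1 Q' <= weight_below m k.+1 Q' + eps.
    apply: contrapT => /forallNP hm; apply: (light Q'); first by rewrite mem_head.
    by exists eps => // m; rewrite leNgt; apply/negP => /ltW; exact: hm.
  exists (maxn m n) => P; rewrite inE => /orP[/eqP ->|/hn Pn].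
    by apply: le_trans hm _; rewrite lerD2r weight_below_mono// leq_maxl.
  by apply: le_trans Pn _; rewrite lerD2r weight_below_mono// leq_maxr.
have : weight_below n k Q + eta <= weight_below n k Q + (size (ch k Q))%:R * eps.
  apply: le_trans (hQ n) _; apply: le_trans (phi_sub k Q) _.
  rewrite big_seq; apply: le_trans (ler_sum _ hn) _.
  rewrite big_split/= -!big_seq big_const_seq count_predT iter_addr addr0 mulr_natl.
  by rewrite lerD2r weight_below_children.
rewrite lerD2l leNgt => /negP; apply.
by rewrite /eps mulrCA gtr_pMr// ltr_pdivrMr// mul1r ltr_nat.
Qed.

(** Replaces compactness: a family whose total weight is below the mass of the root
    misses a whole branch, except for members lighter than the mass at their level. *)
Lemma heavy_branch Q0 (eta : R) : 0 < eta ->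
  (forall n, \sum_(i < n) w i * (size (L i))%:R + eta <= phi 0%N Q0) ->
  exists Q : nat -> T, [/\ Q 0%N = Q0, forall k, par k (Q k.+1) = Q k,
    forall k, 0 < phi k (Q k) &
    forall i, Q (lev i) \in L i -> w i < phi (lev i) (Q (lev i))].
Proof.
move=> eta0 hQ0.
have heavy0 : heavy 0 Q0.
  exists eta => // n; apply: le_trans (hQ0 n); rewrite lerD2r /weight_below.
  by apply: ler_sum => i _; rewrite ler_wpM2l// ler_nat count_size.
have /choice[nx nxP] : forall kQ : nat * T, exists Q', heavy kQ.1 kQ.2 ->
    par kQ.1 Q' = kQ.2 /\ heavy kQ.1.+1 Q'.
  move=> [k Q] /=; have [/heavy_child[Q' ? ?]|] := pselect (heavy k Q); first by exists Q'.
  by exists Q.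
pose Q := fix Q k := if k is k'.+1 then nx (k', Q k') else Q0.
have hQ k : heavy k (Q k) by elim: k => // k /(nxP (k, _))[].
exists Q; split=> // [k|k|i QL].
- by have [] := nxP (k, Q k) (hQ k).
- exact: heavy_phi_gt0.
have [e e0 /(_ i.+1)] := hQ (lev i); apply: lt_le_trans.
rewrite /weight_below big_mkcond big_ord_recr/= leqnn subnn/= ltr_pwDr//.
have /= : (0 < count (pred1 (Q (lev i))) (L i))%N by rewrite -has_count has_pred1.
rewrite -(ler_nat R) => h.
apply: (@le_trans _ _ (w i * (count (pred1 (Q (lev i))) (L i))%:R)).
  by rewrite ler_peMr.
rewrite lerDr; apply: sumr_ge0 => j _; case: ifP => // _; exact: mulr_ge0.
Qed.

End Tree.

(** * Distances making the zigzag tall and thin *)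

Section Clamp.
Variable R : realType.
Implicit Types s t : R.

Definition in01 t := 0 <= t <= 1.

Definition clamp t : R := Num.max 0 (Num.min t 1).

Lemma clamp01 t : in01 (clamp t).
Proof. by rewrite /in01 /clamp le_max lexx/= ge_max ler01 ge_min lexx orbT. Qed.

Lemma clampE t : in01 t -> clamp t = t.
Proof. by move=> /andP[t0 t1]; rewrite /clamp min_l// max_r. Qed.

Lemma clamp_dist s t : `|clamp s - clamp t| <= `|s - t|.
Proof.
have := ler_norm (s - t); have := ler_norm (- (s - t)); rewrite normrN /clamp.
move: `|s - t| => r r1 r2; rewrite ler_norml.
by case: (leP s 1) => s1; case: (leP t 1) => t1; rewrite ?(max_r (@ler01 R));
  case: (leP 0 s) => a1; case: (leP 0 t) => a2;
  apply/andP; split; lra.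
Qed.
End Clamp.

Section Arc_distance.
Variables (R : realType) (M N : nat) (rho : R).
Hypothesis M_gt1 : (1 < M)%N.
Hypothesis N_odd : odd N.
Hypothesis rho_gt0 : 0 < rho.
Hypothesis rho_lt : M%:R * rho < 1.
Local Notation B := (M * N)%N.
Local Notation h := (height M N).
Implicit Types s t x a b : R.

(** What the argument needs of the distance: it dominates the height, and at the
    scales [rho^l] it is the larger of the height and of a time scaled so that
    [B^-l] becomes [rho^l]. Stated as axioms, it covers both the snowflaked zigzag
    and the usual distance on a segment. *)
Record arc_dist (d : R -> R -> R) : Prop := ArcDist {
  arc_dist_sym : forall s t, in01 s -> in01 t -> d s t = d t s;
  arc_dist_triangle : forall s t x, in01 s -> in01 t -> in01 x ->
    d s x <= d s t + d t x;
  arc_dist_height : forall s t, in01 s -> in01 t -> `|h s - h t| <= d s t;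
  arc_dist_small : forall l s t, in01 s -> in01 t ->
    `|s - t| <= B%:R^-1 ^+ l -> `|h s - h t| <= rho ^+ l -> d s t <= rho ^+ l;
  arc_dist_time : forall l s t, in01 s -> in01 t ->
    d s t <= rho ^+ l -> `|s - t| <= B%:R^-1 ^+ l
}.

Let M_gt0 : (0 < M)%N. Proof. exact: ltnW. Qed.
Let B_gt0' : (0 < B)%N. Proof. exact: B_gt0. Qed.
Let MR0 : 0 < M%:R :> R. Proof. by rewrite ltr0n. Qed.
Let BR0 : 0 < B%:R :> R. Proof. by rewrite ltr0n. Qed.

Lemma rho_lt1 : rho < 1.
Proof.
by apply: le_lt_trans rho_lt; rewrite ler_peMl ?(ltW rho_gt0)// ler1n.
Qed.

Lemma invB_lt1 : 0 <= (B%:R^-1 : R) < 1.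
Proof.
rewrite invr_ge0 ler0n invf_lt1 ?ltr0n// ltr1n.
by apply: leq_trans M_gt1 _; rewrite leq_pmulr// N_gt0.
Qed.

(** Two times at distance [B^-k] lie in the same stroke or in two adjacent ones. *)
Lemma height_osc k s t : 0 <= s -> 0 <= t -> `|s - t| <= B%:R^-1 ^+ k ->
  `|h s - h t| <= 2 * M%:R^-1 ^+ k.
Proof.
wlog st : s t / s <= t => [hw s0 t0|s0 t0].
  have [/hw|/ltW /hw] := leP s t; first exact.
  by rewrite distrC [`|h s - _|]distrC; apply.
have Bk0 : 0 < B%:R ^+ k :> R by rewrite exprn_gt0.
have Mk0 : 0 < M%:R ^+ k :> R by rewrite exprn_gt0.
rewrite !exprVn distrC ger0_norm ?subr_ge0// -(ler_pM2l Bk0) divff ?gt_eqF// mulrBr => tBs.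
rewrite ler_pdivlMr// -[X in _ * X](gtr0_norm Mk0) -normrM.
have /andP[n1 n2] := column_itv M N k s0.
set n := column M N k s in n1 n2; rewrite -natr1 in n2.
have hs := height_stroke M_gt1 N_odd (n := n) (k := k) (t := s).
have := hs; rewrite n1 (ltW n2) => /(_ isT)/andP[s1 s2].
have Bst : B%:R ^+ k * s <= B%:R ^+ k * t by rewrite ler_pM2l.
have [tn|nt] := leP (B%:R ^+ k * t) (n%:R + 1).
  have := @height_stroke R M N M_gt1 N_odd k n t.
  rewrite tn (le_trans n1)// => /(_ isT)/andP[t1 t2].
  by rewrite ler_norml; apply/andP; split; lra.
have := @height_stroke R M N M_gt1 N_odd k n.+1 t.
rewrite -natr1 (ltW nt) => /(_ _)/andP[]; first by lra.
pose v : R := n.+1%:R / B%:R ^+ k.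
have vE : B%:R ^+ k * v = n%:R + 1 by rewrite /v mulrC divfK ?gt_eqF// natr1.
have := @height_stroke R M N M_gt1 N_odd k n v; rewrite vE lexx lerDl ler01.
move=> /(_ isT)/andP[v1 v2].
have := @height_stroke R M N M_gt1 N_odd k n.+1 v; rewrite vE -natr1 lexx lerDl ler01.
move=> /(_ isT)/andP[v3 v4] t1 t2.
by rewrite ler_norml; apply/andP; split; lra.
Qed.

Variable d : R -> R -> R.
Hypothesis hd : arc_dist d.

Lemma arc_dist_ge0 s t : in01 s -> in01 t -> 0 <= d s t.
Proof. by move=> s01 t01; apply: le_trans (arc_dist_height hd s01 t01). Qed.

Lemma arc_dist_refl s : in01 s -> d s s = 0.
Proof.
move=> s01; apply/eqP; rewrite eq_le arc_dist_ge0// andbT.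
apply: (@le0_geometric _ rho 1); first by rewrite ltW//= rho_lt1.
by move=> k; rewrite mul1r; apply: (arc_dist_small hd) => //;
  rewrite subrr normr0 exprn_ge0// ?invr_ge0// ltW.
Qed.

Lemma arc_dist_eq0 s t : in01 s -> in01 t -> d s t = 0 -> s = t.
Proof.
move=> s01 t01 dst; apply/eqP; rewrite -subr_eq0 -normr_le0.
apply: (@le0_geometric _ (B%:R^-1) 1 _ invB_lt1) => k.
by rewrite mul1r; apply: (arc_dist_time hd) => //; rewrite dst exprn_ge0 ?ltW.
Qed.

Lemma arc_dist_le1 s t : in01 s -> in01 t -> d s t <= 1.
Proof.
move=> s01 t01; move: (s01) (t01) => /andP[s0 s1] /andP[t0 t1].
have := @height_stroke R M N M_gt1 N_odd 0 0; rewrite /stroke_lo/= => H.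
have /(H s)/andP[] : 0 <= B%:R ^+ 0 * s <= 0 + 1 by rewrite expr0 mul1r add0r s0.
have /(H t)/andP[] : 0 <= B%:R ^+ 0 * t <= 0 + 1 by rewrite expr0 mul1r add0r t0.
rewrite expr0 !mul1r !add0r => *.
rewrite -(expr0 rho); apply: (arc_dist_small hd) => //; rewrite expr0 ler_norml; lra.
Qed.

Lemma arc_dist_continuous l : exists k, forall s t, in01 s -> in01 t ->
  `|s - t| <= B%:R^-1 ^+ k -> d s t <= rho ^+ l.
Proof.
have [k] := exists_expr_lt 2 (invM_lt1 R M_gt1) (exprn_gt0 l rho_gt0).
move=> /ltW Mk; exists (maxn k l) => s t s01 t01 st.
have mono q i j : 0 <= q < 1 -> (j <= i)%N -> q ^+ i <= q ^+ j :> R.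
  by move=> /andP[q0 q1] ji; rewrite ler_wiXn2l// ltW.
apply: (arc_dist_small hd) => //.
  by apply: le_trans st _; rewrite mono ?invB_lt1// leq_maxr.
apply: le_trans Mk; apply: le_trans (height_osc _ _ _) _; last exact: lexx.
- by case/andP: s01.
- by case/andP: t01.
- by apply: le_trans st _; rewrite mono ?invB_lt1// leq_maxl.
Qed.

(** The arc is connected: on the way from [x] to [b] the continuous function [d x]
    takes every value in between. *)
Lemma arc_dist_interpolate x b theta : in01 x -> in01 b -> 0 <= theta <= 1 ->
  exists2 b', in01 b' & d x b' = theta * d x b.
Proof.
move=> x01 b01 /andP[th0 th1].
have cont : continuous (fun t => d x (clamp t)).
  move=> t; apply/cvgrPdist_le => /= e e0.
  have rho01 : 0 <= rho < 1 by rewrite ltW//= rho_lt1.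
  have [l] := exists_expr_lt 1 rho01 e0.
  rewrite mul1r => /ltW le; have [k hk] := arc_dist_continuous l.
  have Bk0 : 0 < B%:R^-1 ^+ k :> R by rewrite exprn_gt0// invr_gt0.
  near=> s.
  have dts : d (clamp t) (clamp s) <= e.
    apply: le_trans le; apply: hk; rewrite ?clamp01//; apply: le_trans (clamp_dist _ _) _.
    near: s; exact: (@cvgr_dist_le _ _ _ (nbhs t)).
  have t01 := clamp01 t; have s01 := clamp01 s.
  have := arc_dist_triangle hd x01 t01 s01.
  have := arc_dist_triangle hd x01 s01 t01.
  rewrite (arc_dist_sym hd (clamp01 s) (clamp01 t)) => *.
  by rewrite ler_norml; apply/andP; split; lra.
have dxb := arc_dist_ge0 x01 b01.
pose f t := d x (clamp t).
have fx : f x = 0 by rewrite /f clampE// arc_dist_refl.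
have fb : f b = d x b by rewrite /f clampE.
have v1 : 0 <= theta * d x b by rewrite mulr_ge0.
have v2 : theta * d x b <= d x b by rewrite ler_piMl.
have [xb|/ltW bx] := leP x b.
  have [|c] := @IVT R f x b (theta * d x b) xb (continuous_subspaceT cont).
    by rewrite fx fb min_l// max_r// v1 v2.
  by move=> _ <-; exists (clamp c); first exact: clamp01.
have [|c] := @IVT R f b x (theta * d x b) bx (continuous_subspaceT cont).
  by rewrite fx fb min_r// max_l// v1 v2.
by move=> _ <-; exists (clamp c); first exact: clamp01.
Unshelve. all: by end_near. Qed.

End Arc_distance.

(** * Distortion under a quasisymmetric map *)

Section Distortion.
Variables (R : realType) (M N : nat) (rho : R).
Hypothesis M_gt1 : (1 < M)%N.
Hypothesis N_odd : odd N.
Hypothesis rho_gt0 : 0 < rho.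
Hypothesis rho_lt : M%:R * rho < 1.
Implicit Types s t x a b : R.

(** The distance pulled back by an embedding, together with the gauge [eta] that
    controls its distortion. *)
Record qs_dist (d de : R -> R -> R) (eta : R -> R) : Prop := QsDist {
  qs_dist_ge0 : forall s t, 0 <= de s t;
  qs_dist_refl : forall s, de s s = 0;
  qs_dist_sym : forall s t, de s t = de t s;
  qs_dist_triangle : forall t s x, de s x <= de s t + de t x;
  qs_gauge_ge0 : forall r, 0 <= r -> 0 <= eta r;
  qs_gauge_mono : forall r r', 0 <= r -> r <= r' -> eta r <= eta r';
  qs_gauge_small : forall e, 0 < e -> exists2 r, 0 < r < 1 & eta r <= e;
  qs_distP : forall a b x, in01 a -> in01 b -> in01 x -> x <> b ->
    de x a <= eta (d x a / d x b) * de x b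
}.

Variables (d de : R -> R -> R) (eta : R -> R).
Hypothesis hd : arc_dist M N rho d.
Hypothesis hde : qs_dist d de eta.

Lemma qs_dist_le K a b x : in01 a -> in01 b -> in01 x -> x <> b ->
  0 <= K -> d x a <= K * d x b -> de x a <= eta K * de x b.
Proof.
move=> a01 b01 x01 xb K0 dab; apply: le_trans (qs_distP hde a01 b01 x01 xb) _.
have dxb : 0 < d x b.
  rewrite lt_neqAle (arc_dist_ge0 hd)// andbT eq_sym.
  by apply/eqP => /(arc_dist_eq0 M_gt1 N_odd rho_gt0 hd x01 b01).
rewrite ler_wpM2r ?(qs_dist_ge0 hde)//; apply: (qs_gauge_mono hde).
  by rewrite divr_ge0 ?(arc_dist_ge0 hd).
by rewrite ler_pdivrMr.
Qed.

(** A gauge alone gives no rate. Choose [D] with [eta (sigma^D) <= 1/2] and go from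
    [b] towards [x] through points at distances [sigma^(i D) * d x b]: each step
    halves the distance between the images. *)
Lemma qs_decay K sigma : 0 <= K -> 0 < sigma < 1 ->
  exists C q, [/\ 0 <= C, 0 < q < 1 & forall k a b x,
    in01 a -> in01 b -> in01 x -> d x a <= K * sigma ^+ k * d x b ->
    de x a <= C * q ^+ k * de x b].
Proof.
move=> K0 /andP[sg0 sg1].
have [|theta /andP[th0 th1] eth] := @qs_gauge_small _ _ _ hde 2^-1; first by rewrite invr_gt0.
have sg01 : 0 <= sigma < 1 by rewrite sg1 ltW.
have [D] := exists_expr_lt 1 sg01 th0; rewrite mul1r => sgD.
have D0 : (0 < D)%N.
  by rewrite lt0n; apply/eqP => D0; move: sgD; rewrite D0 expr0 ltNge ltW.
pose q : R := 2^-1 `^ D%:R^-1.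
have q0 : 0 < q by rewrite powR_gt0// invr_gt0.
have qD : q ^+ D = 2^-1.
  rewrite -powR_mulrn ?ltW// /q -powRrM mulVf ?powRr1 ?invr_ge0//.
  by rewrite pnatr_eq0 -lt0n.
have q1 : q < 1.
  rewrite ltNge; apply/negP => q1; have := exprn_ege1 D q1.
  by rewrite qD; lra.
have sgD1 : sigma ^+ D <= 1 by rewrite exprn_ile1// ltW.
have sgD0 : 0 < sigma ^+ D by rewrite exprn_gt0.
have step m a b x : in01 a -> in01 b -> in01 x -> x <> b ->
    d x a <= K * (sigma ^+ D) ^+ m * d x b -> de x a <= eta K * (q ^+ D) ^+ m * de x b.
  elim: m b => [|m IH] b a01 b01 x01 xb; first by rewrite !expr0 !mulr1; exact: qs_dist_le.
  have [|b' b'01 db'] := arc_dist_interpolate M_gt1 N_odd rho_gt0 rho_lt hd x01 b01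
    (theta := sigma ^+ D).
    by rewrite sgD1 ltW.
  rewrite exprSr mulrA -mulrA -db' => dxa.
  have dxb : 0 < d x b.
    rewrite lt_neqAle (arc_dist_ge0 hd)// andbT eq_sym.
    by apply/eqP => /(arc_dist_eq0 M_gt1 N_odd rho_gt0 hd x01 b01).
  have xb' : x <> b'.
    move=> E; move: db'; rewrite -E (arc_dist_refl M_gt1 rho_gt0 rho_lt hd)//.
    by move/eqP; rewrite eq_sym mulf_eq0 !gt_eqF.
  apply: le_trans (IH b' a01 b'01 x01 xb' dxa) _.
  rewrite exprSr mulrA -[leRHS]mulrA ler_wpM2l//.
    by rewrite mulr_ge0 ?(qs_gauge_ge0 hde)// !exprn_ge0// ltW.
  have := @qs_dist_le (sigma ^+ D) b' b x b'01 b01 x01 xb (ltW sgD0).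
  rewrite db' lexx => /(_ isT)/le_trans; apply; rewrite ler_wpM2r ?(qs_dist_ge0 hde)//.
  by rewrite qD; apply: le_trans eth; apply: (qs_gauge_mono hde); apply: ltW.
have eK0 : 0 <= eta K by exact: (qs_gauge_ge0 hde).
exists (eta K / q ^+ D), q; split; [|by rewrite q0 q1|].
  by rewrite divr_ge0// exprn_ge0// ltW.
move=> k a b x a01 b01 x01 dxa.
have [xb|xb] := pselect (x = b).
  move: dxa; rewrite -xb (arc_dist_refl M_gt1 rho_gt0 rho_lt hd)// mulr0 => dxa.
  have /(arc_dist_eq0 M_gt1 N_odd rho_gt0 hd x01 a01) <- : d x a = 0.
    by apply/eqP; rewrite eq_le dxa (arc_dist_ge0 hd).
  by rewrite (qs_dist_refl hde) mulr0.
have kE := divn_eq k D; have kr := ltn_pmod k D0.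
apply: le_trans (step (k %/ D)%N a b x a01 b01 x01 xb _) _.
  apply: le_trans dxa _; rewrite ler_wpM2r ?(arc_dist_ge0 hd)// ler_wpM2l//.
  rewrite -exprM ler_wiXn2l ?ltW//; rewrite mulnC.
  by rewrite {2}kE leq_addr.
rewrite ler_wpM2r ?(qs_dist_ge0 hde)// -mulrA ler_wpM2l// mulrC ler_pdivlMr ?exprn_gt0//.
rewrite -exprM -exprD ler_wiXn2l ?ltW//.
by rewrite {1}kE mulnC leq_add2l ltnW.
Qed.

End Distortion.

(** * Lanes *)

Section Lane.
Local Open Scope nat_scope.
Variables M N : nat.
Hypothesis M_gt0 : 0 < M.
Hypothesis N_odd : odd N.
Local Notation B := (M * N).

(** Heights, in units of [M^-(k+1)], met by a lane of the stroke [(k, n)] in the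
    order of time; whether the lane uses upward or downward children only exchanges
    the two ends of each child. *)
Definition rung k n i :=
  if stroke_up M N k n then M * stroke_lo M N k n + i else M * stroke_lo M N k n + (M - i).

Lemma rung_start k n : M * stroke_start M N k n = rung k n 0.
Proof.
by rewrite /rung /stroke_start; case: (stroke_up M N k n);
  rewrite /= mulnDr ?muln0 ?muln1 ?subn0.
Qed.

Lemma rung_stop k n : M * stroke_start M N k n.+1 = rung k n M.
Proof.
by rewrite -stop_start// /rung /stroke_stop; case: (stroke_up M N k n);
  rewrite /= mulnDr ?muln0 ?muln1 ?subnn.
Qed.

Lemma rung_step k n i : i < M ->
  rung k n i.+1 = (rung k n i).+1 \/ rung k n i = (rung k n i.+1).+1.
Proof. by rewrite /rung; case: (stroke_up M N k n) => iM; [left|right]; lia. Qed.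

Lemma lane_entry k n i j : i < M -> j < N ->
  stroke_start M N k.+1 (n * B + (i * N + j) + odd j) = rung k n i.
Proof.
move=> iM jN; case oj: (odd j);
  rewrite /= ?addn1 ?addn0 -?stop_start// /stroke_start /stroke_stop /rung;
  rewrite lo_child// up_child// oj; case: (stroke_up M N k n) => /=; lia.
Qed.

Lemma lane_exit k n i j : i < M -> j < N ->
  stroke_start M N k.+1 (n * B + (i * N + j) + ~~ odd j) = rung k n i.+1.
Proof.
move=> iM jN; case oj: (odd j);
  rewrite /= ?addn1 ?addn0 -?stop_start// /stroke_start /stroke_stop /rung;
  rewrite lo_child// up_child// oj; case: (stroke_up M N k n) => /=; lia.
Qed.
End Lane.

Section Strokes.
Variables (R : realType) (M N : nat) (rho : R).
Hypothesis M_gt1 : (1 < M)%N.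
Hypothesis N_odd : odd N.
Hypothesis rho_gt0 : 0 < rho.
Hypothesis rho_lt : M%:R * rho < 1.
Local Notation B := (M * N)%N.
Local Notation h := (height M N).
Variables (d de : R -> R -> R) (eta : R -> R).
Hypothesis hd : arc_dist M N rho d.
Hypothesis hde : qs_dist d de eta.

Let M_gt0 : (0 < M)%N. Proof. exact: ltnW. Qed.
Let B_gt0' : (0 < B)%N. Proof. exact: B_gt0. Qed.
Let MR0 : 0 < M%:R :> R. Proof. by rewrite ltr0n. Qed.
Let BR0 : 0 < B%:R :> R. Proof. by rewrite ltr0n. Qed.
Let BRk0 k : 0 < B%:R ^+ k :> R. Proof. by rewrite exprn_gt0. Qed.

Definition vertex k n : R := n%:R / B%:R ^+ k.

(** The displacement of a stroke in the image. It is the distance of the images of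
    the ends, rather than a diameter, so that it satisfies a triangle inequality
    along a lane. *)
Definition stroke_span k n : R := de (vertex k n) (vertex k n.+1).

Lemma vertex_in01 k n : (n <= B ^ k)%N -> in01 (vertex k n).
Proof.
move=> nB; apply/andP; split; first by rewrite divr_ge0// ltW.
by rewrite ler_pdivrMr// mul1r -natrX ler_nat.
Qed.

Lemma vertex_within k n m m' : (n * B <= m <= n.+1 * B)%N -> (n * B <= m' <= n.+1 * B)%N ->
  `|vertex k.+1 m - vertex k.+1 m'| <= B%:R^-1 ^+ k.
Proof.
move=> /andP[m1 m2] /andP[m1' m2'].
rewrite /vertex -mulrBl normrM [`|(_ ^+ _)^-1|]gtr0_norm ?invr_gt0// exprVn.
rewrite exprSr invfM mulrCA -[leRHS]mulr1 ler_pM2l ?invr_gt0// ler_pdivrMr// mul1r.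
move: m1 m2 m1' m2'; rewrite mulSn -!(ler_nat R) !natrD => *.
by rewrite ler_norml; apply/andP; split; lra.
Qed.

(** Follow the lane of the [j]-th strokes from one end of the parent to the other.
    Two consecutive strokes of the lane have ends at the same height, at time
    distance at most [B^-k]; by [qs_decay] the image of this gap is at most
    [C * q^k] times the displacement of an adjacent stroke. *)
Lemma span_lanes : exists C q, [/\ 0 <= C, 0 < q < 1 &
  forall k n j, (n < B ^ k)%N -> (j < N)%N ->
  stroke_span k n <=
    (1 + C * q ^+ k) * \sum_(0 <= i < M) stroke_span k.+1 (n * B + (i * N + j))].
Proof.
have sg01 : 0 < M%:R * rho < 1 by rewrite mulr_gt0.
have [C [q [C0 q01 Cq]]] :=
  qs_decay M_gt1 N_odd rho_gt0 rho_lt hd hde (ltW MR0) sg01.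
exists (2 * C), q; split => //; first by rewrite mulr_ge0.
move=> k n j nB jN.
pose ent i := (n * B + (i * N + j) + odd j)%N.
pose ext i := (n * B + (i * N + j) + ~~ odd j)%N.
have child_lt i : (i < M)%N -> (i * N + j < B)%N by move=> iM; exact: digit_lt.
have ent_in i : (i < M)%N -> (n * B <= ent i <= n.+1 * B)%N.
  move=> /child_lt ilt; rewrite /ent -addnA leq_addr mulSn addnC leq_add2r.
  by case: (odd j); rewrite /= ?addn0 ?addn1 // ltnW.
have ext_in i : (i < M)%N -> (n * B <= ext i <= n.+1 * B)%N.
  move=> /child_lt ilt; rewrite /ext -addnA leq_addr mulSn addnC leq_add2r.
  by case: (odd j); rewrite /= ?addn0 ?addn1 // ltnW.
have in_01 m : (n * B <= m <= n.+1 * B)%N -> in01 (vertex k.+1 m).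
  move=> /andP[_ mB]; apply: vertex_in01; apply: leq_trans mB _.
  by rewrite expnSr leq_mul2r nB orbT.
have spanE i : stroke_span k.+1 (n * B + (i * N + j)) =
    de (vertex k.+1 (ent i)) (vertex k.+1 (ext i)).
  rewrite /stroke_span /ent /ext; case: (odd j); rewrite /= ?addn0 ?addn1//.
  by rewrite (qs_dist_sym hde).
have hv m : M%:R ^+ k.+1 * h (vertex k.+1 m) = (stroke_start M N k.+1 m)%:R.
  exact: height_vertex.
have Mk0 : 0 < M%:R ^+ k.+1 :> R by rewrite exprn_gt0.
(* two vertices of equal height in one stroke of level [k] are at distance at most
   [rho^k], a small fraction of the height [M^-(k+1)] of its children *)
have gap m m' i x b : (n * B <= m <= n.+1 * B)%N -> (n * B <= m' <= n.+1 * B)%N ->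
    stroke_start M N k.+1 m = stroke_start M N k.+1 m' -> (i < M)%N ->
    (m' = ent i /\ b = vertex k.+1 (ext i) \/ m' = ext i /\ b = vertex k.+1 (ent i)) ->
    x = vertex k.+1 m' ->
    de x (vertex k.+1 m) <= C * q ^+ k * stroke_span k.+1 (n * B + (i * N + j)).
  move=> m_in m'_in mm' iM hb ->.
  have dxa : d (vertex k.+1 m') (vertex k.+1 m) <= rho ^+ k.
    apply: (arc_dist_small hd); [exact: in_01|exact: in_01|exact: vertex_within m'_in m_in|].
    suff -> : h (vertex k.+1 m') = h (vertex k.+1 m) by rewrite subrr normr0 exprn_ge0// ltW.
    by apply: (mulfI (lt0r_neq0 Mk0)); rewrite !hv mm'.
  have b01 : in01 b by case: hb => -[_ ->]; apply: in_01; [exact: ext_in|exact: ent_in].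
  have dxb : M%:R ^- k.+1 <= d (vertex k.+1 m') b.
    apply: le_trans (arc_dist_height hd (in_01 _ m'_in) b01).
    rewrite -(ler_pM2l Mk0) divff ?gt_eqF// -[X in X * `|_|](gtr0_norm Mk0) -normrM mulrBr.
    have rungs : `|(rung M N k n i)%:R - (rung M N k n i.+1)%:R| = 1 :> R.
      have [->|->] := rung_step M_gt0 N_odd k n iM.
        by rewrite -natr1 opprD addrA subrr sub0r normrN normr1.
      by rewrite -natr1 addrAC subrr add0r normr1.
    case: hb => -[-> ->]; rewrite !hv.
      by rewrite lane_entry// lane_exit// rungs.
    by rewrite distrC lane_entry// lane_exit// rungs.
  have -> : stroke_span k.+1 (n * B + (i * N + j)) = de (vertex k.+1 m') b.
    by rewrite spanE; case: hb => -[-> ->] //; rewrite (qs_dist_sym hde).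
  apply: Cq => //; [exact: in_01|exact: in_01|].
  apply: le_trans dxa _.
  have -> : rho ^+ k = M%:R * (M%:R * rho) ^+ k * M%:R ^- k.+1.
    by rewrite exprMn exprSr; field; rewrite ?expf_neq0 ?lt0r_neq0.
  by rewrite ler_pM2l// mulr_gt0// exprn_gt0// mulr_gt0.
pose last i := if i is i'.+1 then ext i' else (n * B)%N.
have last_in i : (i <= M)%N -> (n * B <= last i <= n.+1 * B)%N.
  by case: i => [_|i /ext_in//]; rewrite /last leqnn leq_mul2r leqnSn orbT.
have last_rung i : (i <= M)%N -> stroke_start M N k.+1 (last i) = rung M N k n i.
  case: i => [_|i iM]; first by rewrite /last start_first// rung_start.
  by rewrite /last lane_exit.
have chain m : (m <= M)%N -> de (vertex k.+1 (n * B)) (vertex k.+1 (last m)) <=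
    (1 + C * q ^+ k) * \sum_(0 <= i < m) stroke_span k.+1 (n * B + (i * N + j)).
  elim: m => [_|m IH mM]; first by rewrite big_nil mulr0 (qs_dist_refl hde).
  rewrite big_nat_recr//= mulrDr.
  apply: le_trans (qs_dist_triangle hde (vertex k.+1 (last m)) _ _) _.
  apply: lerD; first exact: IH (ltnW mM).
  apply: le_trans (qs_dist_triangle hde (vertex k.+1 (ent m)) _ _) _.
  rewrite -spanE mulrDl mul1r addrC lerD2l (qs_dist_sym hde).
  apply: (gap _ (ent m) m _ (vertex k.+1 (ext m))) => //.
  - exact: last_in (ltnW mM).
  - exact: ent_in.
  - by rewrite last_rung ?(ltnW mM)// lane_entry.
  - by left.
have vk m : vertex k m = vertex k.+1 (m * B).
  by rewrite /vertex (natrM _ m) exprSr -mulf_div divff ?mulr1 ?gt_eqF.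
rewrite /stroke_span !vk.
apply: le_trans (qs_dist_triangle hde (vertex k.+1 (last M)) _ _) _.
apply: le_trans (lerD (chain M (leqnn M)) (_ : _ <= C * q ^+ k *
  \sum_(0 <= i < M) stroke_span k.+1 (n * B + (i * N + j)))) _; last first.
  rewrite (_ : 1 + 2 * C * q ^+ k = 1 + C * q ^+ k + C * q ^+ k); last by ring.
  by rewrite [leRHS]mulrDl.
have [m ME] : exists m, M = m.+1 by exists M.-1; rewrite prednK.
apply: le_trans (gap (n.+1 * B)%N (last M) m (vertex k.+1 (last M)) (vertex k.+1 (ent m))
  _ _ _ _ _ _) _ => //.
- by rewrite leqnn leq_mul2r leqnSn orbT.
- exact: last_in.
- by rewrite last_rung// start_first// rung_stop.
- by rewrite ME.
- by rewrite ME /=; right.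
have q0 : 0 < q by case/andP: q01.
apply: ler_wpM2l; first by rewrite mulr_ge0// exprn_ge0// ltW.
rewrite (bigD1_seq m) ?iota_uniq ?mem_index_iota ?ME//= lerDl; apply: sumr_ge0 => i _.
exact: (qs_dist_ge0 hde).
Qed.
End Strokes.

(** * Cells *)

Lemma near_iota (m n : nat) : (m < n + 2)%N -> (n < m + 3)%N -> m \in iota (n - 2) 4.
Proof. by move=> *; rewrite mem_iota; apply/andP; split; lia. Qed.

Section Cells.
Variables (R : realType) (M N : nat) (rho : R).
Hypothesis M_gt1 : (1 < M)%N.
Hypothesis N_odd : odd N.
Hypothesis rho_gt0 : 0 < rho.
Hypothesis rho_lt : M%:R * rho < 1.
Local Notation B := (M * N)%N.
Local Notation h := (height M N).
Implicit Types s t x : R.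

Let M_gt0 : (0 < M)%N. Proof. exact: ltnW. Qed.
Let B_gt0' : (0 < B)%N. Proof. exact: B_gt0. Qed.
Let MR0 : 0 < M%:R :> R. Proof. by rewrite ltr0n. Qed.
Let BR0 : 0 < B%:R :> R. Proof. by rewrite ltr0n. Qed.
Let Mk0 k : 0 < M%:R ^+ k :> R. Proof. by rewrite exprn_gt0. Qed.
Let Bk0 k : 0 < B%:R ^+ k :> R. Proof. by rewrite exprn_gt0. Qed.

(** The integer [l] for which [rho^l] is comparable to [M^-k]: the time intervals
    used at level [k] are those of level [l]. *)
Fixpoint scale k : nat :=
  if k is k'.+1 then
    if M%:R ^- k'.+1 <= rho ^+ (scale k').+1 then (scale k').+1 else scale k'
  else 0%N.

Lemma scaleS k : scale k.+1 =
  if M%:R ^- k.+1 <= rho ^+ (scale k).+1 then (scale k).+1 else scale k.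
Proof. by []. Qed.

Arguments scale : simpl never.

Lemma scale_step k : (scale k <= scale k.+1 <= (scale k).+1)%N.
Proof. by rewrite scaleS; case: ifP => _; rewrite ?leqnSn leqnn. Qed.

Lemma scale_le k : (scale k <= k)%N.
Proof. by elim: k => // k IH; have /andP[_ h] := scale_step k; apply: leq_trans h _. Qed.

Lemma scale_homo : {homo scale : j k / (j <= k)%N}.
Proof.
by apply: (homo_leq (fun n => leqnn n) leq_trans) => k; case/andP: (scale_step k).
Qed.

Lemma scale_bounds k : M%:R ^- k <= rho ^+ scale k <= rho^-1 * M%:R ^- k.
Proof.
have rM : M%:R <= rho^-1 by rewrite -[leRHS]mul1r ler_pdivlMr// ltW.
elim: k => [|k /andP[IH1 IH2]].
  by rewrite !expr0 invr1 mulr1 lexx/=; apply: le_trans rM; rewrite ler1n.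
rewrite scaleS.
case: (leP (M%:R ^- k.+1) (rho ^+ (scale k).+1)) => [le|/ltW lt].
  rewrite le/= exprS; apply: (@le_trans _ _ (rho * (rho^-1 * M%:R ^- k))).
    by rewrite ler_pM2l.
  have r1 : 1 <= rho^-1 * M%:R^-1 by rewrite ler_pdivlMr// mul1r.
  rewrite mulVKf ?gt_eqF// [in leRHS]exprS [in leRHS]invfM mulrA.
  by rewrite ler_peMl// invr_ge0 ltW.
apply/andP; split; last by rewrite mulrC ler_pdivlMr// mulrC -exprS.
apply: le_trans IH1; rewrite lef_pV2 ?posrE// exprS ler_peMl ?ltW//.
by rewrite ltr1n.
Qed.

Lemma scale_unbounded L : exists k, (L <= scale k)%N.
Proof.
have [k] := exists_expr_lt (rho^-1) (invM_lt1 R M_gt1) (exprn_gt0 L rho_gt0).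
rewrite exprVn => kL; exists k; rewrite leqNgt; apply/negP => /ltnW SL.
have /andP[_ Sk] := scale_bounds k.
have := le_lt_trans Sk kL; rewrite ltNge => /negP; apply.
by rewrite ler_wiXn2l ?ltW// (rho_lt1 M_gt1 rho_gt0 rho_lt).
Qed.

(** The cell selected by a stroke. It is determined by the first [scale k] pairs of
    digits of the stroke and by all its height digits. *)
Definition cell_index k n : nat * nat := ((n %/ B ^ (k - scale k))%N, stroke_lo M N k n).

Definition parent k (Q : nat * nat) : nat * nat :=
  ((Q.1 %/ B ^ (scale k.+1 - scale k))%N, (Q.2 %/ M)%N).

Definition children k (Q : nat * nat) : seq (nat * nat) :=
  let b := (B ^ (scale k.+1 - scale k))%N in
  [seq (a, y) | a <- iota (Q.1 * b) b, y <- iota (Q.2 * M) M].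

Lemma mem_iota_div m b a : (0 < b)%N -> (a \in iota (m * b) b) = (a %/ b == m)%N.
Proof.
move=> b0; rewrite mem_iota addnC -mulSn eqn_leq leq_divRL// andbC.
by rewrite -[(a %/ b <= m)%N]ltnS ltn_divLR.
Qed.

Lemma mem_children k Q Q' : (Q' \in children k Q) = (parent k Q' == Q).
Proof.
have b0 : (0 < B ^ (scale k.+1 - scale k))%N by rewrite expn_gt0 B_gt0'.
case: Q Q' => [m y] [m' y']; rewrite /parent/= xpair_eqE -!mem_iota_div//.
by apply/allpairsP/andP => [[[a z] [/= am zy [-> ->]]]//|[am zy]]; exists (m', y').
Qed.

Lemma children_uniq k Q : uniq (children k Q).
Proof. by apply: allpairs_uniq; rewrite ?iota_uniq// => -[? ?] [? ?]. Qed.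

Lemma parent_key k n : parent k (cell_index k.+1 n) = cell_index k (n %/ B).
Proof.
have := scale_step k; have := scale_le k; have := scale_le k.+1 => h1 h2 /andP[h3 h4].
rewrite /parent/= lo_parent// /cell_index -!divnMA -expnD -expnS; congr ((n %/ B ^ _)%N, _).
by lia.
Qed.

Definition cell k (Q : nat * nat) t : Prop :=
  [/\ in01 t, Q.1%:R <= B%:R ^+ scale k * t <= Q.1%:R + 1 &
      Q.2%:R <= M%:R ^+ k * h t <= Q.2%:R + 1].

Lemma vertex_scale k m : B%:R ^+ k * vertex R M N k m = m%:R.
Proof. by rewrite /vertex mulrC divfK ?gt_eqF. Qed.

Lemma cell_stroke k n t : (n < B ^ k)%N -> n%:R <= B%:R ^+ k * t <= n%:R + 1 ->
  cell k (cell_index k n) t.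
Proof.
move=> nB nt; have /andP[nt1 nt2] := nt; split; last exact: height_stroke.
- apply/andP; split.
    by rewrite -(pmulr_rge0 _ (Bk0 k)); apply: le_trans nt1.
  rewrite -(ler_pM2l (Bk0 k)) mulr1; apply: le_trans nt2 _.
  by rewrite natr1 -natrX ler_nat.
- have kE := subnK (scale_le k); set r := (k - scale k)%N in kE *.
  have r0 : (0 < B ^ r)%N by rewrite expn_gt0 B_gt0'.
  have -> : B%:R ^+ scale k * t = B%:R ^+ k * t / (B ^ r)%:R.
    by rewrite -{2}kE exprD natrX; field; rewrite !expf_neq0 ?gt_eqF.
  rewrite ler_pdivlMr ?ltr0n// ler_pdivrMr ?ltr0n//; apply/andP; split.
    by apply: le_trans nt1; rewrite -natrM ler_nat leq_divM.
  by apply: le_trans nt2 _; rewrite !natr1 -natrM ler_nat ltn_ceil.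
Qed.

Lemma cell_vertex k n m : (n < B ^ k)%N -> (n <= m <= n.+1)%N ->
  cell k (cell_index k n) (vertex R M N k m).
Proof.
by move=> nB /andP[nm mn]; apply: cell_stroke => //;
  rewrite vertex_scale natr1 !ler_nat nm mn.
Qed.

Variable d : R -> R -> R.
Hypothesis hd : arc_dist M N rho d.

Lemma cell_diam k Q s t : cell k Q s -> cell k Q t -> d s t <= rho^-1 * M%:R ^- k.
Proof.
move=> [s01 /andP[s1 s2] /andP[s3 s4]] [t01 /andP[t1 t2] /andP[t3 t4]].
have /andP[S1 S2] := scale_bounds k; apply: le_trans S2.
apply: (arc_dist_small hd) => //.
  rewrite exprVn -[leRHS]mul1r ler_pdivlMr// -[X in _ * X](gtr0_norm (Bk0 _)) -normrM.
  by rewrite mulrC mulrBr ler_norml; apply/andP; split; lra.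
apply: le_trans S1.
rewrite -[leRHS]mul1r ler_pdivlMr// -[X in _ * X](gtr0_norm (Mk0 _)) -normrM.
by rewrite mulrC mulrBr ler_norml; apply/andP; split; lra.
Qed.

Lemma height_ge0 t : in01 t -> 0 <= h t.
Proof.
move=> /andP[t0 t1].
have := @height_stroke R M N M_gt1 N_odd 0 0 t.
rewrite /stroke_lo/= !expr0 !mul1r add0r t0 t1.
by move=> /(_ isT)/andP[].
Qed.

(** The times and the heights of [A] stay within one interval length of those of a
    point of [A], so they meet at most four consecutive closed intervals each. *)
Lemma cells_near (A : set R) k : (forall t, A t -> in01 t) ->
  (forall s t, A s -> A t -> d s t <= M%:R ^- k) ->
  exists2 L : seq (nat * nat), size L = 16%N &
    forall Q t, A t -> cell k Q t -> Q \in L.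
Proof.
move=> A01 Ad; have [[x Ax]|A0] := pselect (exists x, A x); last first.
  by exists (nseq 16 (0, 0)%N) => // Q t At; case: A0; exists t.
pose a0 := column M N (scale k) x; pose y0 := Num.truncn (M%:R ^+ k * h x).
exists [seq (a, y) | a <- iota (a0 - 2) 4, y <- iota (y0 - 2) 4].
  by rewrite size_allpairs !size_iota.
move=> [a y] t At [t01 /andP[t1 t2] /andP[t3 t4]].
rewrite [(a, y).1]/= in t1 t2; rewrite [(a, y).2]/= in t3 t4.
have x01 := A01 _ Ax; have /andP[x0 _] := x01.
have /andP[S1 S2] := scale_bounds k.
have dxt := Ad _ _ Ax At.
have := arc_dist_time hd x01 t01 (le_trans dxt S1).
rewrite exprVn -[X in _ <= X -> _]mul1r ler_pdivlMr// -[X in _ * X](gtr0_norm (Bk0 _)) -normrM.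
rewrite mulrC mulrBr ler_norml => /andP[b1 b2].
have := le_trans (arc_dist_height hd x01 t01) dxt.
rewrite -[X in _ <= X -> _]mul1r ler_pdivlMr// -[X in _ * X](gtr0_norm (Mk0 _)) -normrM.
rewrite mulrC mulrBr ler_norml => /andP[b3 b4].
have /andP[c1 c2] := column_itv M N (scale k) x0; rewrite -/a0 in c1 c2.
have /andP[c3 c4] : y0%:R <= M%:R ^+ k * h x < y0.+1%:R.
  by apply: truncn_itv; rewrite mulr_ge0 ?height_ge0// ltW.
apply: (allpairs_f (fun a y : nat => (a, y))); apply: near_iota.
- by rewrite -(ltr_nat R) natrD; rewrite -natr1 in c2; lra.
- by rewrite -(ltr_nat R) natrD; lra.
- by rewrite -(ltr_nat R) natrD; rewrite -natr1 in c4; lra.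
- by rewrite -(ltr_nat R) natrD; lra.
Qed.

Lemma nested_point (l u : nat -> R) : {homo l : j k / (j <= k)%N >-> j <= k} ->
  {homo u : j k / (j <= k)%N >-> k <= j} -> (forall k, l k <= u k) ->
  exists x, forall k, l k <= x <= u k.
Proof.
move=> l_inc u_dec lu.
have lu' j k : l j <= u k.
  apply: (le_trans (l_inc _ _ (leq_maxl j k))); apply: le_trans (lu _) _.
  exact/u_dec/leq_maxr.
exists (sup (range l)) => k; apply/andP; split.
  by apply: ub_le_sup; [exists (u 0%N) => _ [j _ <-]|exists k].
by apply: ge_sup; [exists (l 0%N), 0%N|move=> _ [j _ <-]].
Qed.

(** The time intervals shrink to a point [x]. The height intervals contain the
    heights of points arbitrarily close to [x], and are closed. *)
Lemma branch_point (Q : nat -> nat * nat) : (forall k, parent k (Q k.+1) = Q k) ->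
  (forall k, exists2 n, (n < B ^ k)%N & cell_index k n = Q k) ->
  exists x, forall k, cell k (Q k) x.
Proof.
move=> Qpar Qkey.
pose l k : R := (Q k).1%:R / B%:R ^+ scale k.
pose u k : R := ((Q k).1%:R + 1) / B%:R ^+ scale k.
pose l' k : R := (Q k).2%:R / M%:R ^+ k.
pose u' k : R := ((Q k).2%:R + 1) / M%:R ^+ k.
have nest (b m : nat) : (0 < b)%N -> (m %/ b)%:R <= m%:R / b%:R :> R /\
    (m%:R + 1) / b%:R <= (m %/ b)%:R + 1 :> R.
  move=> b0; rewrite ler_pdivlMr ?ltr0n// ler_pdivrMr ?ltr0n// !natr1 -!natrM !ler_nat.
  by rewrite leq_divM ltn_ceil.
have BS k : B%:R ^+ scale k.+1 = (B ^ (scale k.+1 - scale k))%:R * B%:R ^+ scale k :> R.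
  by rewrite natrX -exprD subnK//; case/andP: (scale_step k).
have bgt k : (0 < B ^ (scale k.+1 - scale k))%N by rewrite expn_gt0 B_gt0'.
have l_inc : {homo l : j k / (j <= k)%N >-> j <= k}.
  apply: (homo_leq (fun x => lexx x) le_trans) => k.
  rewrite /l -{1}(Qpar k) BS invfM mulrA ler_pM2r ?invr_gt0//=.
  by case: (nest _ (Q k.+1).1 (bgt k)).
have u_dec : {homo u : j k / (j <= k)%N >-> k <= j}.
  apply: (homo_leq (r := fun x y => y <= x) (fun x => lexx x)) => [y x z yx zy|k].
    exact: le_trans zy yx.
  rewrite /u -(Qpar k) BS invfM mulrA ler_pM2r ?invr_gt0//=.
  by case: (nest _ (Q k.+1).1 (bgt k)).
have l'_inc : {homo l' : j k / (j <= k)%N >-> j <= k}.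
  apply: (homo_leq (fun x => lexx x) le_trans) => k.
  rewrite /l' -{1}(Qpar k) exprS invfM mulrA ler_pM2r ?invr_gt0//=.
  by case: (nest _ (Q k.+1).2 M_gt0).
have u'_dec : {homo u' : j k / (j <= k)%N >-> k <= j}.
  apply: (homo_leq (r := fun x y => y <= x) (fun x => lexx x)) => [y x z yx zy|k].
    exact: le_trans zy yx.
  rewrite /u' -(Qpar k) exprS invfM mulrA ler_pM2r ?invr_gt0//=.
  by case: (nest _ (Q k.+1).2 M_gt0).
have [|x xP] := nested_point l_inc u_dec.
  by move=> k; rewrite ler_pM2r ?invr_gt0// lerDl.
have xt k : (Q k).1%:R <= B%:R ^+ scale k * x <= (Q k).1%:R + 1.
  by have := xP k; rewrite /l /u ler_pdivrMr// ler_pdivlMr// mulrC.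
have x01 : in01 x.
  have [n] := Qkey 0; rewrite expn0 ltnS leqn0 => /eqP -> Q0.
  by have := xt 0; rewrite -Q0 /= div0n expr0 mul1r add0r.
exists x => k; split => //.
(* strokes selecting ever smaller cells come close to [x], also in height *)
have close j : exists2 y, l' k <= y <= u' k & `|y - h x| <= 1 * M%:R^-1 ^+ j.
  have [m jm] := scale_unbounded j; pose i := maxn k m.
  have [n nB nQ] := Qkey i.
  have [t01 tt ty] : cell i (Q i) (vertex R M N i n).
    by rewrite -nQ; apply: cell_vertex => //; rewrite leqnn leqnSn.
  exists (h (vertex R M N i n)).
    have := l'_inc _ _ (leq_maxl k m); have := u'_dec _ _ (leq_maxl k m).
    rewrite -/i /l' /u' => hu hl.
    move/andP: ty => [y1 y2]; apply/andP; split.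
      by apply: le_trans hl _; rewrite ler_pdivrMr// mulrC.
    by apply: le_trans hu; rewrite ler_pdivlMr// mulrC.
  have /andP[p1 p2] := height_stroke M_gt1 N_odd tt.
  have /andP[p3 p4] := height_stroke M_gt1 N_odd (xt i).
  have ji : (j <= scale i)%N by apply: leq_trans jm _; apply: scale_homo; exact: leq_maxr.
  apply: (@le_trans _ _ (M%:R^-1 ^+ scale i)).
    rewrite exprVn -[leRHS]mul1r ler_pdivlMr// -[X in _ * X](gtr0_norm (Mk0 _)) -normrM.
    by rewrite mulrC mulrBr ler_norml; apply/andP; split; lra.
  have /andP[M0 M1] := invM_lt1 R M_gt1.
  by rewrite mul1r ler_wiXn2l// ltW.
suff : l' k <= h x <= u' k by rewrite /l' /u' ler_pdivrMr// ler_pdivlMr// mulrC.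
apply/andP; split; rewrite -subr_le0; apply: (le0_geometric (invM_lt1 R M_gt1)) => j.
  have [y /andP[y1 y2] yj] := close j; apply: le_trans yj.
  by apply: le_trans (ler_norm _); rewrite lerD2r.
have [y /andP[y1 y2] yj] := close j; apply: le_trans yj.
by rewrite distrC; apply: le_trans (ler_norm _); rewrite lerD2l lerN2.
Qed.

End Cells.

(** * The mass of a cell *)

(** The factors [1 + C q^k] have a convergent product; the exponential of the
    partial sums is a convenient majorant. *)
Lemma geometric_growth (R : realType) (C q : R) : 0 <= C -> 0 < q < 1 ->
  exists P : nat -> R, exists K : R, [/\ P 0%N = 1, forall k, 1 <= P k <= K &
    forall k, P k * (1 + C * q ^+ k) <= P k.+1].
Proof.
move=> C0 /andP[q0 q1]; have q1' : 0 < 1 - q by rewrite subr_gt0.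
exists (fun k => expR (C * (1 - q ^+ k) / (1 - q))), (expR (C / (1 - q))); split => [|k|k].
- by rewrite expr0 subrr mulr0 mul0r expR0.
- have qk : 0 <= 1 - q ^+ k by rewrite subr_ge0 exprn_ile1// ltW.
  rewrite ler_expR -{1}expR0 ler_expR; apply/andP; split.
    by rewrite divr_ge0 ?mulr_ge0// ltW.
  rewrite ler_pM2r ?invr_gt0// ler_piMr// gerBl exprn_ge0// ltW//.
- have -> : C * (1 - q ^+ k.+1) / (1 - q) = C * (1 - q ^+ k) / (1 - q) + C * q ^+ k.
    by rewrite exprS; field; rewrite gt_eqF.
  by rewrite expRD ler_pM2l ?expR_gt0// expR_ge1Dx.
Qed.

Lemma ler_sum_nat_cond (R : numDomainType) n (P : pred nat) (F G : nat -> R) :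
  (forall i, (i < n)%N -> P i -> F i <= G i) ->
  \sum_(0 <= i < n | P i) F i <= \sum_(0 <= i < n | P i) G i.
Proof.
move=> FG; rewrite [leLHS]big_nat_cond [leRHS]big_nat_cond.
by apply: ler_sum => i /andP[/andP[_ iN] Pi]; exact: FG.
Qed.

Lemma sum_fibers (R : zmodType) (I T : eqType) (f : I -> T) (s : seq T) (r : seq I)
    (F : I -> R) : uniq s ->
  \sum_(x <- s) \sum_(i <- r | f i == x) F i = \sum_(i <- r | f i \in s) F i.
Proof.
elim: s => [|x s IH] /=; first by rewrite big_nil big_pred0.
move=> /andP[xs us]; rewrite big_cons IH// [RHS](bigID (fun i => f i == x))/=.
congr (_ + _); apply: eq_bigl => i; rewrite inE.
  by case: eqP => _; rewrite ?andbF.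
by case: eqP => [->|_]; rewrite /= ?andbT// (negbTE xs).
Qed.

Section Lower_bound.
Variables (R : realType) (M N : nat) (rho e : R).
Hypothesis M_gt1 : (1 < M)%N.
Hypothesis N_odd : odd N.
Hypothesis rho_gt0 : 0 < rho.
Hypothesis rho_lt : M%:R * rho < 1.
Hypothesis e_ge0 : 0 <= e.
Hypothesis rhoe : rho `^ e = N%:R^-1.
Local Notation B := (M * N)%N.
Local Notation l := (scale M rho).
Local Notation cell_index := (cell_index M N rho).
Local Notation cell := (cell M N rho).
Local Notation vertex := (vertex R M N).
Variables (d de : R -> R -> R) (eta : R -> R).
Hypothesis hde : qs_dist d de eta.
Local Notation stroke_span := (stroke_span M N de).

Let M_gt0 : (0 < M)%N. Proof. exact: ltnW. Qed.
Let N_gt0' : (0 < N)%N. Proof. exact: N_gt0. Qed.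
Let MR0 : 0 < M%:R :> R. Proof. by rewrite ltr0n. Qed.
Let NR0 : 0 < N%:R :> R. Proof. by rewrite ltr0n. Qed.
Let Mk0 k : 0 < M%:R ^+ k :> R. Proof. by rewrite exprn_gt0. Qed.
Let Nk0 k : 0 < N%:R ^+ k :> R. Proof. by rewrite exprn_gt0. Qed.

(** The displacement, corrected by [P] into a sub-additive quantity, minus the share
    of the stroke in [eps] times the uniform measure. *)
Definition stroke_charge (P : nat -> R) eps k n : R :=
  P k * stroke_span k n - eps / M%:R ^+ k.

(** The normalisation [N^-k] averages over the lanes. *)
Definition mass P eps k (Q : nat * nat) : R :=
  N%:R ^- k * \sum_(0 <= n < B ^ k | cell_index k n == Q) stroke_charge P eps k n.

Lemma charge_children (P : nat -> R) eps (C q : R) k n :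
  (forall k, 0 <= P k) -> (forall k, P k * (1 + C * q ^+ k) <= P k.+1) ->
  (forall j, (j < N)%N ->
    stroke_span k n <=
      (1 + C * q ^+ k) * \sum_(0 <= i < M) stroke_span k.+1 (n * B + (i * N + j))) ->
  N%:R * stroke_charge P eps k n <=
    \sum_(0 <= i < M) \sum_(0 <= j < N) stroke_charge P eps k.+1 (n * B + (i * N + j)).
Proof.
move=> P0 Pk spank; rewrite exchange_big/= mulr_natl.
have -> : stroke_charge P eps k n *+ N = \sum_(0 <= j < N) stroke_charge P eps k n.
  by rewrite big_const_nat subn0 iter_addr addr0.
rewrite [leLHS]big_nat [leRHS]big_nat; apply: ler_sum => j /andP[_ jN].
rewrite /stroke_charge sumrB lerB//; last first.
  rewrite big_const_nat subn0 iter_addr addr0 exprS le_eqVlt.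
  by apply/orP; left; apply/eqP; field; rewrite !gt_eqF//=.
rewrite -mulr_sumr; apply: le_trans (ler_wpM2l (P0 k) (spank j jN)) _.
rewrite mulrA ler_wpM2r//; apply: sumr_ge0 => i _; exact: (qs_dist_ge0 hde).
Qed.

Lemma mass_children (P : nat -> R) eps (C q : R) k Q :
  (forall k, 0 <= P k) -> (forall k, P k * (1 + C * q ^+ k) <= P k.+1) ->
  (forall k n j, (n < B ^ k)%N -> (j < N)%N ->
    stroke_span k n <=
      (1 + C * q ^+ k) * \sum_(0 <= i < M) stroke_span k.+1 (n * B + (i * N + j))) ->
  mass P eps k Q <= \sum_(Q' <- children M N rho k Q) mass P eps k.+1 Q'.
Proof.
move=> P0 Pk spank; rewrite /mass -mulr_sumr sum_fibers ?children_uniq//.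
have -> : \sum_(0 <= n < B ^ k.+1 | cell_index k.+1 n \in children M N rho k Q)
    stroke_charge P eps k.+1 n =
  \sum_(0 <= n < B ^ k * B | cell_index k (n %/ B) == Q) stroke_charge P eps k.+1 n.
  rewrite expnSr; apply: eq_bigl => n; rewrite mem_children//.
  by rewrite parent_key.
rewrite (big_children M_gt0 N_odd _ _ (fun n => cell_index k n == Q)).
rewrite exprSr invfM -mulrA ler_pM2l ?invr_gt0// ler_pdivlMl//.
rewrite mulr_sumr; apply: ler_sum_nat_cond => n nB _.
exact: (charge_children eps P0 Pk (fun j => spank k n j nB)).
Qed.

Lemma strokes_in_cell k Q :
  (\sum_(0 <= n < B ^ k | cell_index k n == Q) 1 <= N ^ (k - l k))%N.
Proof.
case: Q => a y; have kE := subnKC (scale_le M rho k).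
have := @count_strokes M N M_gt0 N_odd (B ^ l k) (l k) (k - l k) a y.
by rewrite -expnD kE.
Qed.

(** At most [N^(k - l)] strokes select the cell [Q]. If their displacements are so
    small that the charges are negative there is nothing to prove; otherwise [F] is
    at least of order [M^-k], hence of order [rho^l], and [N^-l = (rho^l)^e]. *)
Lemma mass_le (P : nat -> R) eps K : 0 < eps -> (forall k, 1 <= P k <= K) ->
  exists2 c, 0 <= c & forall k Q F, 0 <= F ->
    (forall n, (n < B ^ k)%N -> cell_index k n = Q -> stroke_span k n <= F) ->
    mass P eps k Q <= c * F `^ (1 + e).
Proof.
move=> eps0 PK; have /andP[P1 K1] := PK 0; have K0 : 0 < K by lra.
exists (K * (rho^-1 * (K / eps)) `^ e); first by rewrite mulr_ge0 ?powR_ge0// ltW.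
move=> k Q F F0 spanF.
have chF n : (n < B ^ k)%N -> cell_index k n = Q ->
    stroke_charge P eps k n <= K * F - eps / M%:R ^+ k.
  move=> nB nQ; rewrite /stroke_charge lerB//; have /andP[Pk1 PkK] := PK k.
  by apply: ler_pM => //; [lra|exact: (qs_dist_ge0 hde)|exact: spanF].
have le_sum : \sum_(0 <= n < B ^ k | cell_index k n == Q) stroke_charge P eps k n <=
    \sum_(0 <= n < B ^ k | cell_index k n == Q) (K * F - eps / M%:R ^+ k).
  by apply: ler_sum_nat_cond => n nB /eqP nQ; exact: chF.
have rhs0 : 0 <= K * (rho^-1 * (K / eps)) `^ e * F `^ (1 + e).
  by rewrite !mulr_ge0 ?powR_ge0// ltW.
have [g0|g0] := leP (K * F - eps / M%:R ^+ k) 0.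
  apply: le_trans rhs0; rewrite /mass pmulr_rle0 ?invr_gt0//.
  by apply: le_trans le_sum _; apply: sumr_le0.
have KF : eps / M%:R ^+ k < K * F by rewrite -subr_gt0.
have F1 : 0 < F.
  rewrite lt_neqAle F0 andbT eq_sym; apply/eqP => FE.
  by move: KF; rewrite FE mulr0 ltNge divr_ge0// ltW.
have sum_le : \sum_(0 <= n < B ^ k | cell_index k n == Q) stroke_charge P eps k n <=
    N%:R ^+ (k - l k) * (K * F).
  apply: le_trans le_sum _.
  have -> : \sum_(0 <= n < B ^ k | cell_index k n == Q) (K * F - eps / M%:R ^+ k) =
      (\sum_(0 <= n < B ^ k | cell_index k n == Q) 1)%N%:R * (K * F - eps / M%:R ^+ k).
    by rewrite natr_sum mulr_suml; apply: eq_bigr => n _; rewrite mul1r.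
  apply: ler_pM; [exact: ler0n|exact: ltW| |].
    by rewrite -natrX ler_nat strokes_in_cell.
  by rewrite gerBl divr_ge0// ltW.
apply: (@le_trans _ _ (N%:R ^- l k * (K * F))).
  rewrite /mass ler_pdivrMl//; apply: le_trans sum_le _.
  have -> : N%:R ^+ k = N%:R ^+ (k - l k) * N%:R ^+ l k :> R.
    by rewrite -exprD subnK// scale_le.
  by rewrite -!mulrA mulVKf// gt_eqF.
have -> : N%:R ^- l k = (rho ^+ l k) `^ e.
  rewrite -exprVn -rhoe -(powR_mulrn _ (powR_ge0 rho e)) -(powR_mulrn _ (ltW rho_gt0)).
  exact: (powRAC rho e (l k)%:R).
rewrite powRD; last by apply/implyP => _; rewrite gt_eqF.
have X0 : 0 < rho^-1 * (K / eps) by rewrite !mulr_gt0 ?invr_gt0.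
rewrite (powRr1 (ltW F1)) [leLHS]mulrC mulrACA ler_pM2l ?mulr_gt0//.
rewrite -(powRM _ (ltW X0) (ltW F1)).
apply: ge0_ler_powR => //; rewrite ?nnegrE.
- by rewrite exprn_ge0// ltW.
- by rewrite mulr_ge0// ltW.
have /andP[_ Sk] := scale_bounds M_gt1 rho_gt0 rho_lt k.
apply: le_trans Sk _; rewrite -mulrA ler_pM2l ?invr_gt0// mulrAC ler_pdivlMr// mulrC.
exact: ltW.
Qed.

End Lower_bound.

(** * Lower bound for the content of an image *)

Section Cover.
Variables (R : realType) (M N : nat) (rho e : R).
Hypothesis M_gt1 : (1 < M)%N.
Hypothesis N_odd : odd N.
Hypothesis rho_gt0 : 0 < rho.
Hypothesis rho_lt : M%:R * rho < 1.
Hypothesis e_ge0 : 0 <= e.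
Hypothesis rhoe : rho `^ e = N%:R^-1.
Local Notation B := (M * N)%N.
Local Notation cell_index := (cell_index M N rho).
Local Notation cell := (cell M N rho).
Local Notation vertex := (vertex R M N).
Variables (d de : R -> R -> R) (eta : R -> R).
Hypothesis hd : arc_dist M N rho d.
Hypothesis hde : qs_dist d de eta.
Hypothesis de01 : 0 < de 0 1.

Let M_gt0 : (0 < M)%N. Proof. exact: ltnW. Qed.
Let MR0 : 0 < M%:R :> R. Proof. by rewrite ltr0n. Qed.
Let Mk0 k : 0 < M%:R ^+ k :> R. Proof. by rewrite exprn_gt0. Qed.
Let in0 : in01 (0 : R). Proof. by rewrite /in01 lexx ler01. Qed.
Let in1 : in01 (1 : R). Proof. by rewrite /in01 lexx ler01. Qed.

Lemma span_le k Q x F : cell k Q x ->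
  (forall t, cell k Q t -> de x t <= F) ->
  forall n, (n < B ^ k)%N -> cell_index k n = Q -> stroke_span M N de k n <= 2 * F.
Proof.
move=> Qx QF n nB nQ; rewrite /stroke_span.
apply: le_trans (qs_dist_triangle hde x _ _) _.
rewrite (qs_dist_sym hde _ x) [2 * F]mulr_natl mulr2n.
by apply: lerD; apply: QF; rewrite -nQ; apply: cell_vertex => //;
  rewrite leqnn leqnSn.
Qed.

Lemma far_point (x y z : R) (r : R) : in01 x -> in01 y -> in01 z -> r < d y z ->
  r / 2 < d x y \/ r / 2 < d x z.
Proof.
move=> x01 y01 z01 ryz; have := arc_dist_triangle hd y01 x01 z01.
rewrite (arc_dist_sym hd y01 x01) => tri.
by case: (ltP (r / 2) (d x y)) => h1; [left|right; lra].
Qed.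

Lemma arc_dist01 : 1 <= d 0 1.
Proof.
apply: le_trans (arc_dist_height hd in0 in1).
have := @height_vertex R M N M_gt1 N_odd 0 0; have := @height_vertex R M N M_gt1 N_odd 0 1.
rewrite !expr0 !divr1 !mul1r /stroke_start /stroke_lo /stroke_up/= => -> ->.
by rewrite sub0r normrN normr1.
Qed.

(** If [A] has two points, take the level whose cells are as large as [A]; then each
    of the cells meeting [A] has an image of size comparable to that of [A], by
    quasisymmetry. A single point is put into cells so small that they weigh at most
    [delta]. *)
Lemma cover_weight P eps K : 0 < eps -> (forall k, 1 <= P k <= K) ->
  exists2 c, 0 < c & forall (A : set R) D delta, (forall t, A t -> in01 t) ->
    0 <= D -> (forall s t, A s -> A t -> de s t <= D) -> 0 < delta ->
    exists k, exists2 L : seq (nat * nat), size L = 16%N &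
      forall Q t, A t -> cell k Q t ->
        Q \in L /\ mass M N rho de P eps k Q <= c * D `^ (1 + e) + delta.
Proof.
move=> eps0 PK.
have [c c0 hc] := mass_le M_gt1 N_odd rho_gt0 rho_lt e_ge0 rhoe hde eps0 PK.
pose K2 : R := 2 * M%:R * rho^-1.
have K20 : 0 <= K2 by rewrite !mulr_ge0// invr_ge0 ltW.
have eK2 : 0 <= eta K2 by exact: (qs_gauge_ge0 hde).
exists (c * (2 * eta K2) `^ (1 + e) + 1).
  by rewrite ltr_wpDl// mulr_ge0// powR_ge0.
move=> A D delta A01 D0 AD delta0.
have cD0 : 0 <= (c * (2 * eta K2) `^ (1 + e) + 1) * D `^ (1 + e).
  by rewrite mulr_ge0 ?powR_ge0// addr_ge0// mulr_ge0// powR_ge0.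
have [[y [z [Ay Az yz]]]|sub] := pselect (exists y z, [/\ A y, A z & y <> z]).
- have y01 := A01 _ Ay; have z01 := A01 _ Az.
  have dyz : 0 < d y z.
    rewrite lt_neqAle (arc_dist_ge0 hd)// andbT eq_sym.
    by apply/eqP => /(arc_dist_eq0 M_gt1 N_odd rho_gt0 hd y01 z01).
  (* the last [k] for which [M^-k] still bounds the diameter of [A] *)
  have [k [Ak [y' [z' [Ay' Az' dyz']]]]] : exists k,
      (forall s t, A s -> A t -> d s t <= M%:R ^- k) /\
      exists y z, [/\ A y, A z & M%:R ^- k.+1 < d y z].
    have [k0 hk0] := exists_expr_lt 1 (invM_lt1 R M_gt1) dyz.
    rewrite mul1r in hk0.
    pose p k := `[< exists y z, [/\ A y, A z & M%:R ^- k < d y z] >].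
    have exp : exists k, p k by exists k0; apply/asboolP; exists y, z; rewrite -exprVn.
    case: (ex_minnP exp) => -[|k] /asboolP[y' [z' [Ay' Az' h']]] kmin.
      have := arc_dist_le1 M_gt1 N_odd hd (A01 _ Ay') (A01 _ Az').
      by rewrite leNgt => /negP; case; rewrite expr0 invr1 in h'.
    exists k; split; last by exists y', z'.
    move=> s t As At; rewrite leNgt; apply/negP => hst.
    suff /kmin : p k by rewrite ltnn.
    by apply/asboolP; exists s, t.
  have [L sL hL] := cells_near M_gt1 N_odd rho_gt0 rho_lt hd A01 Ak.
  exists k, L => // Q t At Qt; split; first exact: hL Qt.
  have t01 := A01 _ At.
  have [b Ab db] : exists2 b, A b & M%:R ^- k.+1 / 2 < d t b.
    by have [] := far_point t01 (A01 _ Ay') (A01 _ Az') dyz'; [exists y'|exists z'].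
  have F x : cell k Q x -> de t x <= eta K2 * D.
    move=> Qx; have [x01 _ _] := Qx.
    have tb : t <> b.
      move=> E; move: db; rewrite -E (arc_dist_refl M_gt1 rho_gt0 rho_lt hd)//.
      by rewrite ltNge divr_ge0// invr_ge0 ltW.
    apply: (@le_trans _ _ (eta K2 * de t b)); last by rewrite ler_wpM2l// AD.
    apply: (qs_dist_le M_gt1 N_odd rho_gt0 hd hde) => //; first exact: A01.
    have := cell_diam M_gt1 N_odd rho_gt0 rho_lt hd Qt Qx => dtx.
    apply: le_trans dtx _.
    have -> : rho^-1 * M%:R ^- k = K2 * (M%:R ^- k.+1 / 2).
      by rewrite /K2 exprS; field; rewrite !gt_eqF//=.
    by rewrite ler_wpM2l// ltW.
  have F0 : 0 <= 2 * (eta K2 * D) by rewrite !mulr_ge0.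
  apply: le_trans (hc k Q _ F0 (span_le Qt F)) _.
  rewrite mulrA powRM ?mulr_ge0// mulrA -[leLHS]addr0 lerD ?(ltW delta0)//.
  by rewrite ler_wpM2r ?powR_ge0// lerDl.
- have [[x Ax]|A0] := pselect (exists x, A x); last first.
    by exists 0%N, (nseq 16 (0, 0)%N); rewrite ?size_nseq// => Q t At; case: A0; exists t.
  have Ax' t : A t -> t = x.
    by move=> At; apply: contrapT => tx; apply: sub; exists t, x.
  have x01 := A01 _ Ax.
  have [b b01 db] : exists2 b, in01 b & 4^-1 < d x b.
    have h01 : 2^-1 < d 0 1 by apply: lt_le_trans arc_dist01; rewrite invf_lt1// ltr1n.
    have E : 2^-1 / 2 = 4^-1 :> R by rewrite -invfM -natrM.
    by have [] := far_point x01 in0 in1 h01; rewrite E; [exists 0|exists 1].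
  have sg01 : 0 < (M%:R^-1 : R) < 1 by rewrite invr_gt0 ltr0n M_gt0 invf_lt1 ?ltr0n// ltr1n.
  have K30 : 0 <= 4 * rho^-1 by rewrite mulr_ge0// invr_ge0 ltW.
  have [C [q [C0 q01 Cq]]] := qs_decay M_gt1 N_odd rho_gt0 rho_lt hd hde K30 sg01.
  pose tau := Num.min 1 (delta / (c + 1)).
  have c1 : 0 < c + 1 by rewrite ltr_wpDl.
  have tau0 : 0 < tau by rewrite lt_min ltr01 divr_gt0.
  have [q0 q1] := andP q01.
  have q01' : 0 <= q < 1 by rewrite q1 ltW.
  have [k hk] := exists_expr_lt (2 * C * de x b) q01' tau0.
  have Ak s t : A s -> A t -> d s t <= M%:R ^- k.
    by move=> /Ax' -> /Ax' ->; rewrite (arc_dist_refl M_gt1 rho_gt0 rho_lt hd)//.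
  have [L sL hL] := cells_near M_gt1 N_odd rho_gt0 rho_lt hd A01 Ak.
  exists k, L => // Q t At Qt; split; first exact: hL Qt.
  move: Qt; rewrite (Ax' _ At) => Qx.
  have F s : cell k Q s -> de x s <= tau / 2.
    move=> Qs; have [s01 _ _] := Qs.
    have dxs := cell_diam M_gt1 N_odd rho_gt0 rho_lt hd Qx Qs.
    apply: (@le_trans _ _ (C * q ^+ k * de x b)).
      apply: Cq => //; apply: le_trans dxs _; rewrite exprVn.
      have -> : 4 * rho^-1 * M%:R ^- k * d x b = (rho^-1 * M%:R ^- k) * (4 * d x b) by ring.
      rewrite ler_peMr//; first by rewrite mulr_ge0 ?invr_ge0 ?ltW.
      by rewrite -ler_pdivrMl// mulr1 ltW.
    have E : C * q ^+ k * de x b * 2 = 2 * C * de x b * q ^+ k by ring.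
    by rewrite ler_pdivlMr// E ltW.
  have tau20 : 0 <= 2 * (tau / 2) by rewrite mulr_ge0// divr_ge0// ltW.
  apply: le_trans (hc k Q _ tau20 (span_le Qx F)) _.
  rewrite [2 * _]mulrC divfK ?pnatr_eq0//.
  apply: (@le_trans _ _ delta); last by rewrite lerDr.
  apply: (@le_trans _ _ ((c + 1) * tau)).
    apply: ler_pM => //; first exact: powR_ge0; first by rewrite lerDl.
    apply: ge1r_powR; last by rewrite lerDl.
    by rewrite tau0/= ge_min lexx.
  by rewrite mulrC -ler_pdivlMr// ge_min lexx orbT.
Qed.

(** The sets [A i] are the preimages of a cover of the image and [D i] bounds the
    diameter of the image of [A i]. *)
Theorem image_content_gt : exists2 kappa, 0 < kappa &
  forall (A : nat -> set R) (D : nat -> R),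
    (forall i t, A i t -> in01 t) -> (forall t, in01 t -> exists i, A i t) ->
    (forall i, 0 <= D i) -> (forall i s t, A i s -> A i t -> de s t <= D i) ->
    exists n, kappa < \sum_(i < n) D i `^ (1 + e).
Proof.
have [C [q [C0 q01 spanC]]] := span_lanes M_gt1 N_odd rho_gt0 rho_lt hd hde.
have [P [K [P0 PK Pstep]]] := geometric_growth C0 q01.
pose m0 := de 0 1 / 2; have m00 : 0 < m0 by rewrite divr_gt0.
have [c c0 hc] := cover_weight m00 PK.
exists (m0 / (64 * c)); first by rewrite divr_gt0// mulr_gt0.
move=> A D A01 Acov D0 AD; apply: contrapT => /forallNP small.
pose delta i : R := m0 / 128 * 2^-1 ^+ i.
have delta0 i : 0 < delta i.
  by apply: mulr_gt0; [exact: divr_gt0|rewrite exprn_gt0// invr_gt0].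
have /choice[lev /choice[L hL]] : forall i, exists k, exists L : seq (nat * nat),
    size L = 16%N /\ forall Q t, A i t -> cell k Q t -> Q \in L /\
      mass M N rho de P m0 k Q <= c * D i `^ (1 + e) + delta i.
  by move=> i; have [k [L ? ?]] := hc (A i) (D i) (delta i) (A01 i) (D0 i) (AD i) (delta0 i);
    exists k, L.
pose w i := c * D i `^ (1 + e) + delta i.
have w0 i : 0 <= w i by rewrite addr_ge0 ?(ltW (delta0 i))// mulr_ge0 ?powR_ge0// ltW.
have massch k Q : mass M N rho de P m0 k Q <=
    \sum_(Q' <- children M N rho k Q) mass M N rho de P m0 k.+1 Q'.
  apply: (mass_children M_gt1 N_odd rho_gt0 rho_lt hde _ (q := q) (C := C)) => // j.
  by have /andP[h _] := PK j; exact: le_trans ler01 h.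
have mass0 : mass M N rho de P m0 0 (0, 0)%N = m0.
  rewrite /mass !expr0 invr1 mul1r expn0 big_mkcond big_nat1 /cell_index div0n /stroke_lo/=.
  rewrite /stroke_charge P0 mul1r /stroke_span /vertex !expr0 !divr1.
  by rewrite /m0; lra.
have wsum n : \sum_(i < n) w i * (size (L i))%:R + m0 / 2 <=
    mass M N rho de P m0 0 (0, 0)%N.
  rewrite mass0.
  have -> : \sum_(i < n) w i * (size (L i))%:R =
      16 * (c * \sum_(i < n) D i `^ (1 + e) + m0 / 128 * \sum_(i < n) 2^-1 ^+ i).
    rewrite 2!mulr_sumr -big_split/= mulr_sumr; apply: eq_bigr => i _.
    by have [-> _] := hL i; rewrite mulrC.
  have g2 : \sum_(i < n) (2^-1 : R) ^+ i <= 2.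
    suff : \sum_(i < n) (2^-1 : R) ^+ i = 2 - 2 * 2^-1 ^+ n.
      by move=> ->; rewrite gerBl mulr_ge0// exprn_ge0// invr_ge0.
    elim: n => [|n IH]; first by rewrite big_ord0 expr0 mulr1 subrr.
    by rewrite big_ord_recr/= IH exprS; field.
  have Dn : c * \sum_(i < n) D i `^ (1 + e) <= m0 / 64.
    have := small n; move=> /negP; rewrite -leNgt => hn.
    apply: le_trans (ler_wpM2l (ltW c0) hn) _.
    by rewrite le_eqVlt; apply/orP; left; apply/eqP; field; rewrite gt_eqF.
  have Dd : m0 / 128 * \sum_(i < n) 2^-1 ^+ i <= m0 / 64.
    apply: le_trans (ler_wpM2l _ g2) _; first by rewrite divr_ge0// ltW.
    by rewrite le_eqVlt; apply/orP; left; apply/eqP; field.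
  lra.
have [Q [Q0 Qpar Qpos Qw]] := heavy_branch (mem_children rho M_gt1 N_odd)
  (children_uniq M N rho) massch lev w0 (divr_gt0 m00 (ltr0n R 2)) wsum.
have Qkey k : exists2 n, (n < B ^ k)%N & cell_index k n = Q k.
  apply: contrapT => no; have := Qpos k; rewrite /mass big_nat_cond big_pred0 ?mulr0 ?ltxx//.
  by move=> n; apply/negbTE/negP => /andP[/andP[_ nB] /eqP nQ]; apply: no; exists n.
have [x Qx] := branch_point M_gt1 N_odd rho_gt0 rho_lt Qpar Qkey.
have [x01 _ _] := Qx 0%N.
have [i Aix] := Acov x x01.
have [_ /(_ _ _ Aix (Qx (lev i)))[QL]] := hL i.
by rewrite leNgt => /negP; apply; exact: Qw.
Qed.

End Cover.

(** * The arc as a metric space *)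

Lemma metric_continuous (R : realType) (T : metricType R) (c : T -> R) :
  (forall x e, 0 < e -> exists2 r, 0 < r & forall z, mdist x z < r -> `|c x - c z| < e) ->
  continuous c.
Proof.
move=> c_cont x; apply/cvgrPdist_lt => e e0; have [r r0 hr] := c_cont x e e0.
apply: filterS (nbhsx_ballx x r r0) => z; rewrite ballEmdist; exact: hr.
Qed.

Record metric01 (R : realType) (d : R -> R -> R) : Prop := Metric01 {
  metric01_refl : forall s, in01 s -> d s s = 0;
  metric01_eq0 : forall s t, in01 s -> in01 t -> d s t = 0 -> s = t;
  metric01_sym : forall s t, in01 s -> in01 t -> d s t = d t s;
  metric01_triangle : forall t s x, in01 s -> in01 t -> in01 x ->
    d s x <= d s t + d t x
}.

(** The proof [hd] is an argument so that the metric can be attached to the type. *)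
Definition arc_space (R : realType) (d : R -> R -> R) (hd : metric01 d) : Type :=
  {t : R | in01 t}.

Section Arc_space.
Variables (R : realType) (d : R -> R -> R) (hd : metric01 d).
Local Notation X := (arc_space hd).

HB.instance Definition _ := Choice.copy X {t : R | in01 t}.

Definition arc_coord (x : X) : R := sval x.
Definition arc_point (t : R) : X := exist _ (clamp t) (clamp01 t).

Lemma arc_coord01 (x : X) : in01 (arc_coord x). Proof. exact: (svalP x). Qed.

Lemma arc_coord_inj : injective arc_coord.
Proof. by move=> x y; exact: val_inj. Qed.

Definition arc_mdist (x y : X) : R := d (arc_coord x) (arc_coord y).

Lemma arc_mdist_refl x : arc_mdist x x = 0.
Proof. exact: (metric01_refl hd (arc_coord01 x)). Qed.

Lemma arc_mdist_eq0 x y : arc_mdist x y = 0 -> x = y.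
Proof.
by move=> xy; apply/arc_coord_inj/(metric01_eq0 hd) => //; exact: arc_coord01.
Qed.

Lemma arc_mdist_sym x y : arc_mdist x y = arc_mdist y x.
Proof. exact: (metric01_sym hd (arc_coord01 x) (arc_coord01 y)). Qed.

Lemma arc_mdist_triangle y x z : arc_mdist x z <= arc_mdist x y + arc_mdist y z.
Proof. by apply: (metric01_triangle hd); exact: arc_coord01. Qed.

HB.instance Definition _ := @isMetric.Build R X arc_mdist
  arc_mdist_refl arc_mdist_eq0 arc_mdist_sym arc_mdist_triangle.

Lemma arc_pointK (x : X) : arc_point (arc_coord x) = x.
Proof. by apply: arc_coord_inj; rewrite /= clampE// arc_coord01. Qed.

Lemma arc_coordK t : in01 t -> arc_coord (arc_point t) = t.
Proof. exact: clampE. Qed.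

Lemma mdist_arc (x y : X) : mdist x y = d (arc_coord x) (arc_coord y).
Proof. by []. Qed.

Lemma arc_space_jordan :
  (forall e, 0 < e -> exists2 r, 0 < r &
     forall s t, in01 s -> in01 t -> `|s - t| <= r -> d s t < e) ->
  (forall e, 0 < e -> exists2 r, 0 < r &
     forall s t, in01 s -> in01 t -> d s t < r -> `|s - t| < e) ->
  jordan_arc (X : metricType R).
Proof.
move=> d_small coord_small; exists arc_point; split.
- split=> [//|s t|x _].
    rewrite !inE/= !in_itv/= => s01 t01 st.
    by rewrite -(arc_coordK s01) -(arc_coordK t01) st.
  by exists (arc_coord x); [rewrite /= in_itv/=; exact: arc_coord01|exact: arc_pointK].
- apply: continuous_subspaceT => t; apply/cvg_ballP => e e0.
  have [r r0 hr] := d_small e e0.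
  near=> s; rewrite ballEmdist /= mdist_arc; apply: hr; rewrite ?arc_coord01//.
  apply: le_trans (clamp_dist _ _) _.
  near: s; exact: (@cvgr_dist_le _ _ _ (nbhs t)).
- exists (fun y : [set: X] => arc_coord (\val y)); split=> [y|y]; last first.
    by rewrite /= in_itv/= arc_pointK; split => //; exact: arc_coord01.
  have cont_coord : continuous (arc_coord : (X : metricType R) -> R).
    apply: metric_continuous => x e e0; have [r r0 hr] := coord_small e e0.
    by exists r => // z; apply: hr; exact: arc_coord01.
  apply: (@continuous_comp _ _ _ (\val : [set: X] -> X) arc_coord).
    exact: initial_continuous.
  exact: cont_coord.
Unshelve. all: by end_near. Qed.

End Arc_space.

Section Gauge.
Variable R : realType.

(** An injective continuous function on a half-line is monotone; being onto the
    half-line it is increasing and vanishes at [0]. *)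
Lemma homeo_halfline_gauge (eta : R -> R) :
  homeomorphism `[0 : R, +oo[ `[0 : R, +oo[ eta ->
  [/\ forall r, 0 <= r -> 0 <= eta r,
      forall r r', 0 <= r -> r <= r' -> eta r <= eta r' &
      forall e, 0 < e -> exists2 r, 0 < r < 1 & eta r <= e].
Proof.
move=> [[eta_fun eta_inj eta_surj] eta_cont _].
have eta0 r : 0 <= r -> 0 <= eta r.
  by move=> r0; have := eta_fun r; rewrite /= !in_itv/= !andbT; apply.
have onto v : 0 <= v -> exists2 r, 0 <= r & eta r = v.
  move=> v0; have [|r] := eta_surj v; first by rewrite /= in_itv/= andbT.
  by rewrite /= in_itv/= andbT => r0 rv; exists r.
have [r0 r00 er0] := onto 0 (lexx _).
have mono : {in `[0, +oo[ &, {mono eta : x y / x <= y}}.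
  apply: itv_continuous_inj_le => //.
    exists r0, (r0 + 1); rewrite !in_itv/= !andbT r00 ltrDl ltr01 er0.
    by rewrite eta0 ?addr_ge0.
  by move=> x y xI yI; apply: eta_inj; rewrite inE.
have eta_mono r r' : 0 <= r -> r <= r' -> eta r <= eta r'.
  move=> r_ge0 rr'; rewrite mono// in_itv/= andbT//; exact: le_trans rr'.
split => // e e0; have [r r_ge0 er] := onto e (ltW e0).
have r_gt0 : 0 < r.
  rewrite lt_neqAle r_ge0 andbT; apply/eqP => rE.
  have := eta_mono 0 r0 (lexx _) r00; rewrite er0 => h.
  by move: e0; rewrite -er -rE ltNge h.
exists (Num.min r 2^-1).
  rewrite lt_min r_gt0 invr_gt0 ltr0n/= gt_min; apply/orP; right.
  by rewrite invf_lt1// ltr1n.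
rewrite -er; apply: eta_mono; last by rewrite ge_min lexx.
by rewrite le_min r_ge0 invr_ge0 ler0n.
Qed.
End Gauge.

Section Image_distance.
Variables (R : realType) (d : R -> R -> R) (hd : metric01 d).
Variables (Y : metricType R) (f : arc_space hd -> Y).
Hypothesis qs : quasisymmetric (f : (arc_space hd : metricType R) -> Y).

Definition image_dist s t := mdist (f (arc_point hd s)) (f (arc_point hd t)).

Lemma quasisymmetric_inj : injective f.
Proof. by case: qs => -[[_ finj _] _ _] _ x y; apply: finj; rewrite inE. Qed.

Lemma image_dist_gt0 s t : in01 s -> in01 t -> s <> t -> 0 < image_dist s t.
Proof.
move=> s01 t01 st; rewrite mdist_gt0; apply/eqP => /quasisymmetric_inj st'.
by apply: st; rewrite -(arc_coordK hd s01) -(arc_coordK hd t01) st'.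
Qed.

Lemma image_qs_dist : exists eta, qs_dist d image_dist eta.
Proof.
have [_ [eta [/homeo_halfline_gauge[eta0 eta_mono eta_small] heta]]] := qs.
exists eta; split => //.
- by move=> s t; exact: mdist_ge0.
- by move=> s; exact: mdistxx.
- by move=> s t; exact: metric_sym.
- by move=> t s x; exact: metric_triangle.
move=> a b x a01 b01 x01 xb.
rewrite -ler_pdivrMr; last exact: image_dist_gt0.
have := heta (arc_point hd a) (arc_point hd b) (arc_point hd x).
rewrite !mdist_arc !arc_coordK//; apply => /(congr1 (@arc_coord _ _ hd)).
by rewrite !arc_coordK.
Qed.
End Image_distance.

(** * Hausdorff measure *)

Section Hausdorff_facts.
Variables (R : realType) (X : metricType R).
Implicit Types (U : set X) (s : R).
Local Open Scope ereal_scope.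

Lemma diameter_ge0 U : 0 <= diameter U.
Proof. by apply: ereal_sup_ubound; left. Qed.

Lemma mdist_le_diameter U x y : U x -> U y -> (mdist x y)%:E <= diameter U.
Proof. by move=> Ux Uy; apply: ereal_sup_ubound; right; exists (x, y). Qed.

Lemma diameter_le U (r : R) : (0 <= r)%R ->
  (forall x y, U x -> U y -> (mdist x y <= r)%R) -> diameter U <= r%:E.
Proof.
move=> r0 Ur; apply: ge_ereal_sup => _ [->|[[x y] /= [Ux Uy] <-]]; rewrite lee_fin//.
exact: Ur.
Qed.

Lemma diameter0 : diameter (set0 : set X) = 0.
Proof. by apply/eqP; rewrite eq_le diameter_ge0 andbT diameter_le. Qed.

Lemma diam_pow_ge0 s U : 0 <= diam_pow s U.
Proof. by rewrite /diam_pow; case: ifP => // _; exact: poweR_ge0. Qed.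

Lemma diam_pow_le s U (r : R) : (0 <= s)%R -> (0 <= r)%R ->
  diameter U <= r%:E -> diam_pow s U <= (r `^ s)%:E.
Proof.
move=> s0 r0; rewrite /diam_pow; case: ifP => _; first by rewrite lee_fin powR_ge0.
have := diameter_ge0 U; case: (diameter U) => // u; rewrite poweR_EFin !lee_fin => u0 ur.
exact: ge0_ler_powR.
Qed.

Lemma diam_pow_ge s c U (r : R) : (s < c)%R -> (0 < c)%R -> (r <= 1)%R ->
  diameter U = r%:E -> (r `^ c)%:E <= diam_pow s U.
Proof.
move=> sc c0 r1 Ur; have r0 : (0 <= r)%R by rewrite -lee_fin -Ur diameter_ge0.
have [rE|rn0] := eqVneq r 0%R.
  by rewrite rE powR0 ?gt_eqF// diam_pow_ge0.
rewrite /diam_pow; case: eqP => [U0|_].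
  by move: Ur; rewrite U0 diameter0 => -[/esym/eqP]; rewrite (negbTE rn0).
rewrite Ur poweR_EFin lee_fin; apply: ger_powR; last exact: ltW.
by rewrite r1 andbT lt_neqAle eq_sym rn0.
Qed.

Lemma hausdorff_premeasure_ge0 s delta U : 0 <= hausdorff_premeasure s delta U.
Proof.
by apply: le_ereal_inf_tmp => _ [V _ <-]; apply: nneseries_ge0 => i _ _; exact: diam_pow_ge0.
Qed.

Lemma hausdorff_premeasure_le s delta (r : R) n (U : nat -> set X) A :
  (0 <= s)%R -> (0 <= r <= delta)%R -> A `<=` \bigcup_(i in `I_n) U i ->
  (forall i x y, U i x -> U i y -> (mdist x y <= r)%R) ->
  hausdorff_premeasure s delta A <= (n%:R * r `^ s)%:E.
Proof.
move=> s0 /andP[r0 rd] AU Ur; pose V i := if (i < n)%N then U i else set0.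
have Vr i : diameter (V i) <= r%:E.
  by apply: diameter_le => // x y; rewrite /V; case: ifP => // _; exact: Ur.
apply: ge_ereal_inf; exists (\sum_(0 <= i <oo) diam_pow s (V i)).
  exists V => //; split.
    by move=> x /AU[i /= iltn Uix]; exists i => //; rewrite /V iltn.
  by move=> i; apply: le_trans (Vr i) _; rewrite lee_fin.
apply: lime_le; first by apply: is_cvg_nneseries => i _ _; exact: diam_pow_ge0.
apply: nearW => m.
apply: (@le_trans _ _ (\sum_(0 <= i < m) (if (i < n)%N then (r `^ s)%:E else 0))).
  apply: lee_sum => i _; have := Vr i; rewrite /V; case: ifP => _ Vi.
    exact: diam_pow_le.
  by rewrite /diam_pow eqxx.
have -> : \sum_(0 <= i < m) (if (i < n)%N then (r `^ s)%:E else 0) =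
    ((minn m n)%:R * r `^ s)%:E.
  elim: m => [|m IH]; first by rewrite big_nil min0n mul0r.
  rewrite big_nat_recr//= IH; case: ltnP => mn.
    by rewrite (minn_idPl mn) -EFinD -natr1 mulrDl mul1r.
  by rewrite adde0 (minn_idPr (leqW mn)).
by rewrite lee_fin ler_wpM2r ?powR_ge0// ler_nat geq_minr.
Qed.

End Hausdorff_facts.

Section Quasisymmetric_id.
Variables (R : realType).

Lemma embedding_id (X : topologicalType) : embedding (@id X).
Proof.
split.
- split=> [x _|x y _ _//|_ [x _ <-]]; [by exists x|by exists x].
- by apply: continuous_subspaceT => x; exact: cvg_id.
- exists (fun y : range (@id X) => \val y); split=> [|y]; last by split.
  exact: initial_continuous.
Qed.

Lemma quasisymmetric_id (X : metricType R) : quasisymmetric (@id X).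
Proof.
split; first exact: embedding_id.
exists id; split=> [|a b x _]; last exact: lexx.
split.
- by split=> [x //|x y //|x xI]; exists x.
- by apply: continuous_subspaceT => x; exact: cvg_id.
- exists (fun y : `[0 : R, +oo[%classic => \val y); split=> [|y].
    exact: initial_continuous.
  by split => //; exact: set_valP.
Qed.
End Quasisymmetric_id.

(** * Dimension of the arc *)

Section Arc_dimension.
Variables (R : realType) (M N : nat) (rho e : R).
Hypothesis M_gt1 : (1 < M)%N.
Hypothesis N_odd : odd N.
Hypothesis rho_gt0 : 0 < rho.
Hypothesis rho_lt : M%:R * rho < 1.
Hypothesis e_ge0 : 0 <= e.
Hypothesis rhoe : rho `^ e = N%:R^-1.
Local Notation B := (M * N)%N.
Implicit Types (s delta t : R).
Variables (d : R -> R -> R).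
Hypothesis hd : arc_dist M N rho d.

Let M_gt0 : (0 < M)%N. Proof. exact: ltnW. Qed.
Let B_gt0' : (0 < B)%N. Proof. exact: B_gt0. Qed.
Let MR0 : 0 < M%:R :> R. Proof. by rewrite ltr0n. Qed.
Let BR0 : 0 < B%:R :> R. Proof. by rewrite ltr0n. Qed.
Let Mk0 k : 0 < M%:R ^+ k :> R. Proof. by rewrite exprn_gt0. Qed.
Let Bk0 k : 0 < B%:R ^+ k :> R. Proof. by rewrite exprn_gt0. Qed.
Let N_gt0' : (0 < N)%N. Proof. exact: N_gt0. Qed.
Let NR0 : 0 < N%:R :> R. Proof. by rewrite ltr0n. Qed.

Lemma arc_dist_metric01 : metric01 d.
Proof.
split.
- exact: (arc_dist_refl M_gt1 rho_gt0 rho_lt hd).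
- exact: (arc_dist_eq0 M_gt1 N_odd rho_gt0 hd).
- exact: (arc_dist_sym hd).
- by move=> t s x *; apply: (arc_dist_triangle hd).
Qed.

Definition zigzag_arc : metricType R := arc_space arc_dist_metric01.

Let rho01 : 0 <= rho < 1.
Proof. by rewrite (ltW rho_gt0) (rho_lt1 M_gt1 rho_gt0 rho_lt). Qed.

Lemma jordan_arc_arc : jordan_arc zigzag_arc.
Proof.
apply: arc_space_jordan => r r0.
  have [l] := exists_expr_lt 1 rho01 r0; rewrite mul1r => lr.
  have [k hk] := arc_dist_continuous M_gt1 N_odd rho_gt0 hd l.
  exists (B%:R^-1 ^+ k); first by rewrite exprn_gt0// invr_gt0.
  by move=> s t s01 t01 st; apply: le_lt_trans lr; exact: hk.
have [l] := exists_expr_lt 1 (invB_lt1 R M_gt1 N_odd) r0; rewrite mul1r => lr.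
exists (rho ^+ l); first by rewrite exprn_gt0.
by move=> s t s01 t01 /ltW st; apply: le_lt_trans lr; exact: (arc_dist_time hd).
Qed.

(** For [s < 1 + e], a cover by sets of diameter at most [1] with a small sum of
    [s]-th powers has a sum of [(1 + e)]-th powers that is at least as small. *)
Lemma hausdorff_dim_image_ge (Y : metricType R) (f : zigzag_arc -> Y) :
  quasisymmetric f -> ((1 + e)%:E <= hausdorff_dim (range f))%E.
Proof.
move=> qsf; apply: le_ereal_inf_tmp => _ [s [s0 Hs] <-].
rewrite lee_fin leNgt; apply/negP => sc.
pose point := arc_point arc_dist_metric01.
have [eta qsd] := image_qs_dist qsf.
have de01 : 0 < image_dist f 0 1.
  apply: (image_dist_gt0 qsf); [by rewrite /in01 lexx ler01..|].
  by move/esym/eqP; rewrite oner_eq0.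
have [kappa k0 content] := image_content_gt M_gt1 N_odd rho_gt0 rho_lt e_ge0 rhoe hd qsd de01.
have : (hausdorff_premeasure s 1 (range f) < kappa%:E)%E.
  apply: (@le_lt_trans _ _ 0%E); last by rewrite lte_fin.
  by rewrite -Hs; apply: ereal_sup_ubound; exists 1 => //; exact: ltr01.
move=> /ereal_inf_lt[_ [U [Ucov Udiam] <-] Usum].
pose D i := fine (diameter (U i)).
have DE i : diameter (U i) = (D i)%:E.
  rewrite /D fineK// ge0_fin_numE ?diameter_ge0//.
  by apply: le_lt_trans (Udiam i) _; exact: ltry.
have D0 i : 0 <= D i by rewrite -lee_fin -DE diameter_ge0.
have D1 i : D i <= 1 by rewrite -lee_fin -DE Udiam.
have [||||n] := content (fun i => [set t | in01 t /\ U i (f (point t))]) D.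
- by move=> i t [].
- move=> t t01; have [|i _ Ui] := Ucov (f (point t)); first by exists (point t).
  by exists i.
- exact: D0.
- by move=> i x t [_ Us] [_ Ut]; rewrite -lee_fin -DE; exact: mdist_le_diameter.
apply/negP; rewrite -leNgt -lee_fin; apply: le_trans (ltW Usum).
apply: (@le_trans _ _ (\sum_(0 <= i < n) diam_pow s (U i))%E).
  rewrite big_mkord -sumEFin; apply: lee_sum => i _.
  by apply: diam_pow_ge => //; rewrite ltr_wpDr.
by apply: nneseries_lim_ge => i _ _; exact: diam_pow_ge0.
Qed.

Lemma strokes_cover k (t : R) : in01 t -> exists2 n, (n < B ^ k)%N &
  n%:R <= B%:R ^+ k * t <= n%:R + 1.
Proof.
move=> /andP[t0 t1]; have /andP[n1 n2] := column_itv M N k t0.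
set n := column M N k t in n1 n2; have [nB|Bn] := ltnP n (B ^ k).
  by exists n => //; rewrite n1 natr1 ltW.
exists (B ^ k).-1; first by rewrite prednK ?expn_gt0 ?B_gt0'.
rewrite natr1 prednK ?expn_gt0 ?B_gt0'// natrX ler_piMr ?(ltW (Bk0 k))// andbT.
apply: le_trans n1; rewrite ler_nat; apply: leq_trans Bn; exact: leq_pred.
Qed.

(** The cells of level [k] that are selected by strokes. There are [B^l] time
    intervals, each crossing [M^(k - l)] height intervals. *)
Lemma premeasure_arc_le s delta k : 0 <= s -> rho^-1 * M%:R ^- k <= delta ->
  (hausdorff_premeasure s delta [set: zigzag_arc] <=
   (M%:R ^+ k * N%:R ^+ scale M rho k * (rho^-1 * M%:R ^- k) `^ s)%:E)%E.
Proof.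
move=> s0 hdelta; pose l := scale M rho k; pose r := (M ^ (k - l))%N.
have r0 : (0 < r)%N by rewrite expn_gt0 M_gt0.
pose node m := ((m %/ r)%N, (stroke_lo M N l (m %/ r) * r + m %% r)%N).
have -> : M%:R ^+ k * N%:R ^+ l = (B ^ l * r)%N%:R :> R.
  rewrite natrM !natrX natrM exprMn mulrAC -exprD subnKC//; exact: scale_le.
apply: (@hausdorff_premeasure_le _ zigzag_arc _ _ _ _
  (fun m => [set p : zigzag_arc | cell M N rho k (node m) (arc_coord p)])) => //.
- by rewrite hdelta andbT mulr_ge0// invr_ge0 ltW.
- move=> p _; have p01 := arc_coord01 p.
  have [n nB nt] := strokes_cover k p01.
  have kE := subnKC (scale_le M rho k); rewrite -/l in kE.
  exists ((n %/ B ^ (k - l)) * r + stroke_lo M N k n %% r)%N; rewrite /=.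
    apply: (@leq_trans ((n %/ B ^ (k - l)).+1 * r)%N).
      by rewrite mulSn addnC ltn_add2r ltn_mod.
    rewrite leq_mul2r; apply/orP; right.
    by rewrite ltn_divLR ?expn_gt0 ?B_gt0'// -expnD kE.
  have -> : node ((n %/ B ^ (k - l)) * r + stroke_lo M N k n %% r)%N = cell_index M N rho k n.
    rewrite /node divnMDl// [(_ %% r %/ r)%N]divn_small ?ltn_mod// addn0 modnMDl modn_mod.
    congr pair; rewrite -lo_anc// kE; exact/esym/divn_eq.
  exact: cell_stroke.
- by move=> m x y cx cy; rewrite mdist_arc;
  exact: (cell_diam M_gt1 N_odd rho_gt0 rho_lt hd cx cy).
Qed.

(** With [u = M^-k], the cells of level [k] contribute at most a constant times
    [u^(s - 1 - e)]. *)
Lemma hausdorff_measure_arc0 s : 1 + e < s -> hausdorff_measure s [set: zigzag_arc] = 0%E.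
Proof.
move=> es; have s0 : 0 <= s by apply: le_trans (ltW es); rewrite addr_ge0.
pose q := M%:R^-1 `^ (s - (1 + e)).
have [Mi0 Mi1] := andP (invM_lt1 R M_gt1).
have Mi : 0 < (M%:R^-1 : R) by rewrite invr_gt0.
have q01 : 0 <= q < 1.
  rewrite powR_ge0/=; have := @gt0_ltr_powR R (s - (1 + e)); rewrite subr_gt0 => /(_ es).
  by move=> /(_ M%:R^-1 1); rewrite powR1 !nnegrE => -> //.
have bound k : M%:R ^+ k * N%:R ^+ scale M rho k * (rho^-1 * M%:R ^- k) `^ s <=
    rho^-1 `^ s * q ^+ k.
  set u : R := M%:R ^- k; have u0 : 0 < u by rewrite invr_gt0.
  have -> : M%:R ^+ k = u^-1 by rewrite invrK.
  have -> : q ^+ k = u `^ s / (u * u `^ e).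
    rewrite -(powR_mulrn _ (powR_ge0 _ _)) (powRAC _ (s - (1 + e)) k%:R).
    rewrite (powR_mulrn _ Mi0) exprVn -/u powRB; last by apply/implyP; rewrite (gt_eqF u0).
    by rewrite powRD ?(gt_eqF u0) ?implybT// (powRr1 (ltW u0)).
  have NS : N%:R ^+ scale M rho k <= (u `^ e)^-1.
    have -> : N%:R ^+ scale M rho k = ((rho ^+ scale M rho k) `^ e)^-1.
      rewrite -(powR_mulrn _ (ltW rho_gt0)) (powRAC rho _ e) rhoe.
      by rewrite (powR_mulrn _ (_ : 0 <= N%:R^-1)) ?invr_ge0 ?(ltW NR0)// exprVn invrK.
    rewrite lef_pV2 ?posrE ?powR_gt0 ?exprn_gt0//.
    have /andP[Sk _] := scale_bounds M_gt1 rho_gt0 rho_lt k.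
    by apply: ge0_ler_powR => //; rewrite nnegrE ltW// exprn_gt0.
  rewrite (powRM _ (ltW _) (ltW u0)) ?invr_gt0//.
  have -> : rho^-1 `^ s * (u `^ s / (u * u `^ e)) =
      u^-1 * (u `^ e)^-1 * (rho^-1 `^ s * u `^ s) by rewrite invfM; ring.
  rewrite ler_wpM2r ?mulr_ge0 ?powR_ge0// ler_wpM2l// invr_ge0; exact: ltW.
apply/eqP; rewrite eq_le; apply/andP; split; last first.
  apply: le_ereal_sup_tmp; exists (hausdorff_premeasure s 1 [set: zigzag_arc]).
    by exists 1 => //; exact: ltr01.
  exact: hausdorff_premeasure_ge0.
apply: ge_ereal_sup => _ [delta /= delta0 <-].
apply/lee_addgt0Pr => r r0; rewrite add0e.
have [k1 hk1] := exists_expr_lt rho^-1 (invM_lt1 R M_gt1) delta0.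
have [k2 hk2] := exists_expr_lt (rho^-1 `^ s) q01 r0.
pose k := maxn k1 k2.
apply: le_trans (premeasure_arc_le (k := k) s0 _) _.
  apply: le_trans (ltW hk1); rewrite -exprVn ler_pM2l ?invr_gt0//.
  by rewrite ler_wiXn2l// ?ltW// leq_maxl.
rewrite lee_fin; apply: le_trans (bound k) _; apply: le_trans (ltW hk2).
case/andP: q01 => q0 q1; rewrite ler_wpM2l ?powR_ge0//.
by rewrite ler_wiXn2l// ?ltW// leq_maxr.
Qed.

Theorem conformal_dim_arc : conformal_dim zigzag_arc = (1 + e)%:E.
Proof.
apply/eqP; rewrite eq_le; apply/andP; split; last first.
  by apply: le_ereal_inf_tmp => _ [Y [f [qsf ->]]]; exact: hausdorff_dim_image_ge.
apply: ge_ereal_inf; exists (hausdorff_dim (range (@id zigzag_arc))).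
  by exists zigzag_arc, id; split => //; exact: quasisymmetric_id.
rewrite image_id; apply/lee_addgt0Pr => r r0; rewrite -EFinD.
apply: ereal_inf_lbound; exists (1 + e + r) => //; split.
  by rewrite !addr_ge0// ltW.
by apply: hausdorff_measure_arc0; rewrite ltrDl.
Qed.
End Arc_dimension.

(** * Choice of the parameters *)

Section Snowflake.
Variable R : realType.
Implicit Types (p x y s t : R).

(** Split [(x + y)^p] in proportion to [x] and [y]; the share of [z] is at most [z^p]
    because [r <= r^p] for [0 <= r <= 1]. *)
Lemma powR_le_add p x y : 0 < p <= 1 -> 0 <= x -> 0 <= y ->
  (x + y) `^ p <= x `^ p + y `^ p.
Proof.
move=> /andP[p0 p1] x0 y0.
have [xy0|xy0] := eqVneq (x + y) 0; first by rewrite xy0 powR0 ?gt_eqF// addr_ge0 ?powR_ge0.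
have S0 : 0 < x + y by rewrite lt_neqAle eq_sym xy0 addr_ge0.
have part z : 0 <= z -> z <= x + y -> z / (x + y) * (x + y) `^ p <= z `^ p.
  move=> z0 zS; have [->|zn0] := eqVneq z 0; first by rewrite mul0r mul0r powR_ge0.
  have zpos : 0 < z by rewrite lt_neqAle eq_sym zn0.
  have {2}-> : z = z / (x + y) * (x + y) by rewrite divfK// gt_eqF.
  rewrite powRM ?divr_ge0 ?(ltW S0)// ler_wpM2r ?powR_ge0//.
  by apply: ger1_powR => //; rewrite divr_gt0//= ler_pdivrMr// mul1r.
have <- : x / (x + y) * (x + y) `^ p + y / (x + y) * (x + y) `^ p = (x + y) `^ p.
  by rewrite -mulrDl -mulrDl divff// mul1r.
by apply: lerD; apply: part => //; rewrite ?lerDl ?lerDr.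
Qed.

Lemma snowflake_arc_dist (M N : nat) p : (0 < M * N)%N -> 0 < p <= 1 ->
  arc_dist M N ((M * N)%:R^-1 `^ p)
    (fun s t => Num.max (`|s - t| `^ p) `|height M N s - height M N t|).
Proof.
move=> B0 p01; have /andP[p0 p1] := p01.
have Bi0 l : 0 <= (M * N)%:R^-1 ^+ l :> R by rewrite exprn_ge0// invr_ge0.
have powB l : ((M * N)%:R^-1 `^ p) ^+ l = ((M * N)%:R^-1 ^+ l) `^ p :> R.
  rewrite -(powR_mulrn _ (powR_ge0 _ _)) (powRAC _ p) powR_mulrn//.
split => //.
- by move=> s t _ _; rewrite distrC [`|height _ _ s - _|]distrC.
- move=> s t x _ _ _; rewrite ge_max; apply/andP; split.
    apply: (@le_trans _ _ (`|s - t| `^ p + `|t - x| `^ p)).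
      apply: le_trans (powR_le_add p01 _ _) => //.
      by apply: ge0_ler_powR; rewrite ?nnegrE ?addr_ge0 ?(ltW p0)// ler_distD.
    by apply: lerD; rewrite le_max lexx.
  apply: le_trans (ler_distD (height M N t) _ _) _.
  by apply: lerD; rewrite le_max lexx orbT.
- by move=> s t _ _; rewrite le_max lexx orbT.
- move=> l s t _ _ st hst; rewrite ge_max hst andbT powB.
  by apply: ge0_ler_powR; rewrite ?nnegrE ?(ltW p0).
- move=> l s t _ _; rewrite ge_max powB => /andP[st _].
  rewrite leNgt; apply/negP => lt; move: st; rewrite leNgt => /negP; apply.
  by apply: gt0_ltr_powR; rewrite ?nnegrE.
Qed.

Lemma stroke_trivial M k n : (0 < M)%N -> stroke M 1 k n = (n, true).
Proof.
move=> M0; elim: k n => //= k IH n.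
by rewrite IH modn1 divn1 muln1 addbF mulnC -divn_eq.
Qed.

(** With a single stroke in each block nothing ever turns round. *)
Lemma height_trivial M t : (1 < M)%N -> 0 <= t -> height M 1 t = t.
Proof.
move=> M1 t0; have M0 := ltnW M1.
apply/eqP; rewrite -subr_eq0 -normr_le0.
apply: (le0_geometric (C := 1) (invM_lt1 R M1)) => k.
have /andP[h1 h2] := @height_column R M 1 M1 isT k t t0.
have /andP[c1 c2] := column_itv M 1 k t0.
move: h1 h2; rewrite /stroke_lo stroke_trivial//= => h1 h2.
rewrite muln1 in c1 c2; rewrite -natr1 in c2.
have Mk0 : 0 < M%:R ^+ k :> R by rewrite exprn_gt0// ltr0n.
rewrite mul1r exprVn -[leRHS]mul1r ler_pdivlMr// -[X in _ * X](gtr0_norm Mk0) -normrM.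
by rewrite mulrC mulrBr ler_norml; apply/andP; split; lra.
Qed.

Lemma segment_arc_dist : arc_dist 2 1 (4^-1 : R) (fun s t => `|s - t|).
Proof.
have hE s : in01 s -> height 2 1 s = s by case/andP => s0 _; exact: height_trivial.
split.
- by move=> s t _ _; rewrite distrC.
- by move=> s t x _ _ _; exact: ler_distD.
- by move=> s t s01 t01; rewrite !hE.
- by move=> l s t s01 t01 _; rewrite !hE.
move=> l s t _ _ st; apply: le_trans st _; rewrite muln1.
by apply: lerXn2r; rewrite ?nnegrE ?invr_ge0//; lra.
Qed.

(** Take [M = 3^m], [N = 3^n] and [p = n / (e (n + m))]; then [rho = 3^(- n / e)].
    The condition [M * rho < 1] means [n > e m], and [p <= 1] means
    [n <= e (n + m)]. The first integer [n > e m] satisfies both as soon as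
    [e^2 m >= 1]. *)
Lemma exists_parameters (e : R) : 0 < e -> exists (M N : nat) p,
  [/\ (1 < M)%N, odd N, 0 < p <= 1, M%:R * ((M * N)%:R^-1 `^ p) < 1 &
      ((M * N)%:R^-1 `^ p) `^ e = N%:R^-1].
Proof.
move=> e0; pose m := (Num.truncn (e^-1 ^+ 2)).+1; pose n := (Num.truncn (e * m%:R)).+1.
have m_gt : e^-1 ^+ 2 < m%:R by exact: truncnS_gt.
have em0 : 0 <= e * m%:R by rewrite mulr_ge0// ltW.
have /andP[n_le n_gt] := truncn_itv em0; rewrite -/n in n_gt.
have n0 : 0 < n%:R :> R by rewrite ltr0n.
have m0 : 0 < m%:R :> R by rewrite ltr0n.
have nm0 : 0 < (n + m)%:R :> R by rewrite ltr0n addnS.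
have BE : (3 ^ m * 3 ^ n)%:R^-1 = 3 `^ (- (n + m)%:R) :> R.
  by rewrite -expnD natrX powR_invn// addnC.
pose p := n%:R / (e * (n + m)%:R).
have rhoE : (3 ^ m * 3 ^ n)%:R^-1 `^ p = 3 `^ (- (n%:R / e)) :> R.
  rewrite BE -powRrM /p; congr (_ `^ _).
  by move: (n + m)%:R nm0 => K K0; field; rewrite !gt_eqF.
exists (3 ^ m)%N; exists (3 ^ n)%N; exists p; split.
- by apply: leq_ltn_trans (ltn_expl m (isT : 1 < 3)%N).
- by rewrite oddX orbT.
- rewrite divr_gt0 ?mulr_gt0//= ler_pdivrMr ?mulr_gt0// mul1r natrD mulrDr.
  have e2 : 1 <= e * (e * m%:R).
    by rewrite mulrA -expr2 -ler_pdivrMl ?exprn_gt0// mulr1 -exprVn ltW.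
  have : e * (e * m%:R) <= e * n%:R by rewrite ler_pM2l// ltW.
  have : n%:R <= e * m%:R + 1 by rewrite /n -natr1 lerD2r.
  lra.
- rewrite rhoE natrX -powR_mulrn// -powRD ?pnatr_eq0 ?implybT//.
  have x0 : 0 < n%:R / e - m%:R by rewrite subr_gt0 ltr_pdivlMr// mulrC.
  rewrite (_ : m%:R - n%:R / e = - (n%:R / e - m%:R)); last by rewrite opprB.
  rewrite powRN invf_lt1 ?powR_gt0//.
  have := @gt0_ltr_powR R _ x0 1 3; rewrite powR1 !nnegrE; apply => //; lra.
- by rewrite rhoE -powRrM mulNr divfK ?gt_eqF// powR_invn// natrX.
Qed.
End Snowflake.

Theorem theorem1p5 (R : realType) (c : R) (hc : 1 <= c) :
  exists Lambda : metricType R, jordan_arc Lambda /\ conformal_dim Lambda = c%:E.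
Proof.
have [->|c1] := eqVneq c 1.
  (* [e = 0] and a single stroke in each of two blocks; any [rho < 1/2] would do *)
  have quarter0 : 0 < 4^-1 :> R by rewrite invr_gt0.
  have quarter : 2%:R * 4^-1 < 1 :> R by lra.
  exists (@zigzag_arc R 2 1 4^-1 isT isT quarter0 quarter _ (segment_arc_dist R)); split.
    exact: jordan_arc_arc.
  by rewrite (@conformal_dim_arc R 2 1 4^-1 0) ?addr0// powRr0 invr1.
have e0 : 0 < c - 1 by rewrite subr_gt0 lt_neqAle eq_sym c1.
have [M [N [p [M1 Nodd p01 rho1 rhoe]]]] := exists_parameters e0.
have B0 : (0 < M * N)%N by apply: B_gt0 => //; exact: ltnW.
have rho0 : 0 < (M * N)%:R^-1 `^ p :> R by rewrite powR_gt0// invr_gt0 ltr0n.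
exists (zigzag_arc M1 Nodd rho0 rho1 (snowflake_arc_dist B0 p01)); split.
  exact: jordan_arc_arc.
by rewrite (conformal_dim_arc _ _ _ _ (ltW e0) rhoe) addrC subrK.
Qed.
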